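(* Let $(G,+)$ be a finite abelian group, $V\subseteq G$ a symmetric set of generators, and $\gamma\in(0,\infty)$. (i) The lifted random walk on $G$, with transition semigroup $(P_t)$, satisfies $$\overline t_{\mathrm{rel}}(P)\ \le\ 16e\max\Bigl(\frac{|V|\min(1,\gamma)}{\mathrm{gap}(\Delta)},\frac{1+2|V|}{\gamma}\Bigr).$$ (ii) There exist universal constants $c,C\in(0,\infty)$ (not depending on $G$, $V$, $\gamma$, $\varepsilon$) such that the lifted random walk on $G$ satisfies $$\mathrm{gap}(\mathcal L)\ \ge\ c\,|V|^{-1}\min\bigl(\mathrm{gap}(\Delta)\max(1,\gamma^{-1}),\gamma\bigr)$$ and $$t_{\mathrm{rel}}(P,\varepsilon)\ \le\ C\,|V|\max\Bigl(\frac{\min(1,\gamma)}{\mathrm{gap}(\Delta)},\gamma^{-1}\Bigr)\log(|G|/\varepsilon).$$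
   Context: Symmetric means $V=-V$. The lifted random walk on $G$ is the continuous-time Markov chain with state space $S=G\times V$ and generator $$\mathcal Lf(x,v)=f(x+v,v)-f(x,v)+\gamma(\Pi f-f)(x,v),\qquad \Pi f(x,v)=\frac1{|V|}\sum_{w\in V}f(x,w).$$ Its unique invariant probability measure is $\mu=\mathrm{Unif}(S)$; $P_t=e^{t\mathcal L}$. On functions $g\colon G\to\mathbb R$, $\Delta g(x)=\frac12\sum_{v\in V}(g(x+v)-2g(x)+g(x-v))$, and $\mathrm{gap}(\Delta)$ is its spectral gap in $L^2(\mathrm{Unif}(G))$, i.e. the smallest eigenvalue of $-\Delta$ on mean-zero functions. $L_0^2(\mu)$ denotes the mean-zero functions in $L^2(\mu)$. $\mathrm{gap}(\mathcal L)=\inf\{\mathrm{Re}(\lambda):\lambda\text{ in the (complex) spectrum of }-\mathcal L|_{L_0^2(\mu)}\}$. For $\varepsilon>0$, $t_{\mathrm{rel}}(P,\varepsilon)=\inf\{t\ge0:\|P_t\|_{L_0^2(\mu)\to L_0^2(\mu)}\le\varepsilon\}$. With $\overline P_tf=\frac1t\int_0^tP_sf\,\mathrm ds$, $\overline t_{\mathrm{rel}}(P)=\inf\{t\ge0:\|\overline P_s\|_{L_0^2(\mu)\to L_0^2(\mu)}\le1/e\text{ for all }s\ge t\}$.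
   Formalization: The bound on t_rel(P,ε) is stated for 0 < ε ≤ |G| rather than for all ε > 0; for ε > |G| the right-hand side is negative because log(|G|/ε) < 0, while t_rel(P,ε) ≥ 0, so the bound fails there. *)

(* Defs.v *)
From HB Require Import structures.
From mathcomp Require Import all_boot all_order all_algebra all_fingroup.
From mathcomp Require Import complex.
From mathcomp Require Import all_classical all_reals all_analysis.

Set Implicit Arguments.
Unset Strict Implicit.
Unset Printing Implicit Defensive.

Import Order.TTheory GRing.Theory Num.Theory.
Import numFieldNormedType.Exports.

Local Open Scope classical_set_scope.
Local Open Scope ring_scope.

Section FiniteL2.
Variables (R : realType) (S : finType).

Definition mean (K : fieldType) (f : S -> K) : K :=
  #|S|%:R^-1 * \sum_s f s.

Definition L20 (K : fieldType) : set (S -> K) := [set f | mean f = 0].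
Arguments L20 K : clear implicits.

Definition L2norm (f : S -> R) : R := Num.sqrt (mean (fun s => f s ^+ 2)).

(* Extended-real valued; for linear T, equal to 0 when L^2_0 is the zero space. *)
Definition opnorm (T : (S -> R) -> (S -> R)) : \bar R :=
  ereal_sup [set (L2norm (T f))%:E | f in [set f | L20 R f /\ L2norm f <= 1]].

Definition complexify (T : (S -> R) -> (S -> R)) (f : S -> R[i]) : S -> R[i] :=
  fun s => (T (fun s' => complex.Re (f s')) s
            +i* T (fun s' => complex.Im (f s')) s)%C.

Definition spectrum0 (T : (S -> R) -> (S -> R)) : set R[i] :=
  [set z | ~ set_bij (L20 R[i]) (L20 R[i])
               (fun f s => z * f s - complexify T f s)].

(* All infima are taken in the extended reals, with inf set0 = +oo: a spectral
   gap is +oo exactly when there are no eigenvalues, i.e. when L^2_0 = 0. *)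
Definition spectral_gap (T : (S -> R) -> (S -> R)) : \bar R :=
  ereal_inf [set (complex.Re z)%:E | z in spectrum0 (fun f s => - T f s)].

Definition eigenvalues0 (T : (S -> R) -> (S -> R)) : set R :=
  [set a | exists f : S -> R,
     [/\ L20 R f, exists s, f s != 0 & forall s, T f s = a * f s]].

Definition smallest_eigenvalue0 (T : (S -> R) -> (S -> R)) : \bar R :=
  ereal_inf [set a%:E | a in eigenvalues0 T].

Definition semigroup (T : (S -> R) -> (S -> R)) (t : R) (f : S -> R) : S -> R :=
  fun s => limn [series exp_coeff t n * iter n T f s]_n.

(* At t = 0 this is the zero operator, since 0^-1 = 0; the value there does not
   affect the infimum in tbar_rel. *)
Definition averaged (P : R -> (S -> R) -> (S -> R)) (t : R) (f : S -> R) :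
    S -> R :=
  fun s => t^-1 * \int[lebesgue_measure]_(u in `[0, t]) P u f s.

Definition t_rel (P : R -> (S -> R) -> (S -> R)) (eps : R) : \bar R :=
  ereal_inf [set t%:E | t in
    [set t | 0 <= t /\ (opnorm (P t) <= eps%:E)%E]].

Definition tbar_rel (P : R -> (S -> R) -> (S -> R)) : \bar R :=
  ereal_inf [set t%:E | t in
    [set t | 0 <= t /\
       forall s, t <= s -> (opnorm (averaged P s) <= ((expR 1)^-1)%:E)%E]].

End FiniteL2.

Arguments L20 {S} K f.

Section LiftedWalk.
Variables (R : realType) (G : finZmodType) (V : {set G}).

Definition symmetric_generators : Prop :=
  V = [set - v | v in V]%SET /\ <<V>>%g = [set: G]%SET.

Definition state : finType := (G * {v : G | v \in V})%type.

Definition refresh (f : state -> R) : state -> R :=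
  fun s => #|V|%:R^-1 * \sum_(w : {v : G | v \in V}) f (s.1, w).

Definition lifted_gen (gamma : R) (f : state -> R) : state -> R :=
  fun s => f (s.1 + val s.2, s.2) - f s + gamma * (refresh f s - f s).

Definition laplacian (g : G -> R) : G -> R :=
  fun x => 2^-1 * \sum_(v in V) (g (x + v) - 2 * g x + g (x - v)).

Definition gap_laplacian : \bar R :=
  smallest_eigenvalue0 (fun g x => - laplacian g x).

Definition lifted_semigroup (gamma : R) := semigroup (lifted_gen gamma).

End LiftedWalk.

Arguments lifted_gen {R G} V gamma f.
Arguments lifted_semigroup {R G} V gamma t f.

(* Main.v *)
Require Import Defs.
From HB Require Import structures.
From mathcomp Require Import all_boot all_order all_algebra all_fingroup.
From mathcomp Require Import complex.
From mathcomp Require Import all_classical all_reals all_analysis.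
From mathcomp Require Import ring lra.

Set Implicit Arguments.
Unset Strict Implicit.
Unset Printing Implicit Defensive.

Import Order.TTheory GRing.Theory Num.Theory.
Import numFieldNormedType.Exports.
Local Open Scope ring_scope.

(* Write L = E - gamma (1 - Pi) with E f(x,v) = f(x+v,v) - f(x,v), m = Pi f,
   b = f - m, n = |V| and Lambda = - Delta.

   (i) Since P_t h - h is the integral of P_u L h, the averages satisfy
   ||avg_t f|| <= 2 ||L^-1 f|| / t, and it suffices to bound L^-1 on L^2_0.
   For gamma >= 1 the plain dissipation of ||f||^2 controls m. For gamma < 1 one
   tests the equation L f = h against E u with Lambda u = m: the leading term is
   2 ||m||^2, and the second differences of u in the directions of V are
   controlled by Lambda u because they commute and are nonnegative.

   (ii) For gamma < 1, subtracting from ||f||^2 / 2 the correlation of b with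
   E u, where u = c gamma (gamma^2 + Lambda)^-1 m, gives a quadratic form which
   is equivalent to ||f||^2 and decays along the semigroup at rate of order
   min(gap / gamma, gamma) / n; for gamma >= 1 the form ||f||^2 / 2 itself decays at
   the required rate. Such a form bounds both ||P_t|| and the spectrum.

   Inner products are unnormalised sums. If |G| = 1, then L^2_0 = 0. *)

(** * Inner product and linear maps on functions on a finite set *)

Section InnerProduct.
Variables (R : realFieldType) (S : finType).
Implicit Types f g h : S -> R.

Definition dot f g : R := \sum_s f s * g s.

Lemma dotC f g : dot f g = dot g f.
Proof. by apply: eq_bigr => s _; rewrite mulrC. Qed.

Lemma dotDl f g h : dot (f + g) h = dot f h + dot g h.
Proof. by rewrite -big_split; apply: eq_bigr => s _; rewrite mulrDl. Qed.

Lemma dotDr f g h : dot h (f + g) = dot h f + dot h g.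
Proof. by rewrite dotC dotDl !(dotC h). Qed.

Lemma dotZl a f g : dot (a *: f) g = a * dot f g.
Proof. by rewrite mulr_sumr; apply: eq_bigr => s _; rewrite -mulrA. Qed.

Lemma dotZr a f g : dot g (a *: f) = a * dot g f.
Proof. by rewrite dotC dotZl (dotC g). Qed.

Lemma dotNl f g : dot (- f) g = - dot f g.
Proof. by rewrite -scaleN1r dotZl mulN1r. Qed.

Lemma dotNr f g : dot g (- f) = - dot g f.
Proof. by rewrite dotC dotNl (dotC g). Qed.

Lemma dot0l f : dot 0 f = 0.
Proof. by rewrite -(scale0r f) dotZl mul0r. Qed.

Definition dotE := (dotDl, dotDr, dotNl, dotNr, dotZl, dotZr).

Lemma dot_ge0 f : 0 <= dot f f.
Proof. by apply: sumr_ge0 => s _; rewrite -expr2 sqr_ge0. Qed.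

Lemma dot_eq0 f : dot f f = 0 -> f = 0.
Proof.
move=> /eqP; rewrite psumr_eq0; last by move=> s _; rewrite -expr2 sqr_ge0.
move=> /allP f0; apply/funext => s; apply/eqP.
by have := f0 s (mem_index_enum s); rewrite /= mulf_eq0 orbb.
Qed.

Lemma dot_gt0 f : f != 0 -> 0 < dot f f.
Proof.
by move=> f0; rewrite lt_neqAle dot_ge0 andbT eq_sym; apply: contra_neq f0 => /dot_eq0.
Qed.

Lemma dot_amgm k f g : 0 < k -> 2 * dot f g <= k * dot f f + k^-1 * dot g g.
Proof.
move=> k0; have := dot_ge0 (k *: f - g); rewrite !dotE (dotC g f) => H.
have -> : k * dot f f + k^-1 * dot g g
  = k^-1 * (k * (k * dot f f) - k * dot f g - (k * dot f g - dot g g)) + 2 * dot f g.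
  by field; rewrite gt_eqF.
by rewrite lerDr; apply: mulr_ge0; [rewrite invr_ge0 ltW | lra].
Qed.

Lemma dot_amgmN k f g : 0 < k -> - (2 * dot f g) <= k * dot f f + k^-1 * dot g g.
Proof.
by move=> k0; have := dot_amgm (- f) g k0; rewrite !dotE mulrN opprK.
Qed.

Lemma dot_cauchy f g : dot f g ^+ 2 <= dot f f * dot g g.
Proof.
have [->|f0] := eqVneq f 0; first by rewrite !dot0l mul0r expr0n.
have ff := dot_gt0 f0.
have := dot_ge0 (dot f f *: g - dot f g *: f); rewrite !dotE (dotC g f) => H.
rewrite -subr_ge0 -(pmulr_rge0 _ ff); lra.
Qed.

(** Cauchy-Schwarz in each coordinate [t], summed over [t]. It bounds a linear map, or its inverse,
    from the images of the delta functions. *)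
Lemma lincomb_bounded (e : S -> S -> R) :
  exists2 C, 0 < C &
    forall c, dot (\sum_s c s *: e s) (\sum_s c s *: e s) <= C * dot c c.
Proof.
exists (1 + \sum_t dot (e^~ t) (e^~ t)).
  by rewrite ltr_wpDr// sumr_ge0// => t _; exact: dot_ge0.
move=> c; rewrite mulrDl mul1r ler_wpDl ?dot_ge0// mulr_suml.
apply: ler_sum => t _; rewrite mulrC [leRHS]mulrC.
have -> : (\sum_s c s *: e s) t = dot c (e^~ t).
  by rewrite fct_sumE; apply: eq_bigr.
by rewrite -expr2; exact: dot_cauchy.
Qed.

End InnerProduct.


(** * Linear maps on a finite-dimensional function space *)

Section LinearMaps.
Variables (K : numFieldType) (S : finType).
Implicit Types (f g : S -> K) (T : (S -> K) -> (S -> K)).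

Definition delta (s t : S) : K := (s == t)%:R.

Lemma delta_expand f : f = \sum_s f s *: delta s.
Proof.
apply/funext => t; rewrite fct_sumE (bigD1 t)//= big1 ?addr0; last first.
  move=> s /negbTE st; rewrite /delta; change (f s * (s == t)%:R = 0).
  by rewrite st mulr0.
by change (f t = f t * (t == t)%:R); rewrite eqxx mulr1.
Qed.

Lemma linear_zero (I J : Type) (U : (I -> K) -> (J -> K)) : linear U -> U 0 = 0.
Proof.
by move=> Ul; have := Ul (-1) 0 0; rewrite scaler0 addr0 => ->; rewrite scaleN1r addNr.
Qed.

Lemma linear_sum T : linear T ->
  forall (I : finType) (c : I -> K) (F : I -> S -> K),
  T (\sum_i c i *: F i) = \sum_i c i *: T (F i).
Proof.
move=> Tl I c F; have T0 := linear_zero Tl.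
by elim/big_rec2: _ => // i y1 y2 _ <-; rewrite Tl.
Qed.

(** Rank-nullity, carried out on [{ffun S -> K^o}], which has a finite-dimensional vector space
    structure. *)
Lemma linear_inj_surj T : linear T -> (forall f, T f = 0 -> f = 0) ->
  forall g, exists f, T f = g.
Proof.
move=> Tl T0 g.
pose tau (p : {ffun S -> K^o}) : {ffun S -> K^o} := finfun (T p).
have taul : linear tau.
  move=> a p q; apply/ffunP => s; rewrite !ffunE.
  have -> : (a *: p + q : {ffun S -> K^o}) = a *: (p : S -> K) + (q : S -> K) :> (S -> K).
    by apply/funext => t; rewrite !ffunE.
  by rewrite Tl.
pose tl : {linear {ffun S -> K^o} -> {ffun S -> K^o}} :=
  HB.pack tau (GRing.isLinear.Build _ _ _ _ tau taul).
have ker0 : lker (linfun tl) == 0%VS.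
  apply/lker0P => p q; rewrite !lfunE /= => pq.
  suff : (p : S -> K) - (q : S -> K) = 0.
    move=> h0; apply/ffunP => s; apply/eqP; rewrite -subr_eq0.
    by apply/eqP; exact: (congr1 (@^~ s) h0).
  apply: T0; have := Tl (-1) (q : S -> K) (p : S -> K).
  rewrite !scaleN1r => E; rewrite addrC E; apply/funext => s.
  have := congr1 (fun h : {ffun S -> K^o} => h s) pq.
  by rewrite !ffunE fctE /= => ->; rewrite addNr.
have : finfun g \in limg (linfun tl) by rewrite lker0_limgf // memvf.
move=> /memv_imgP [p _]; rewrite lfunE /= => gp; exists p.
by apply/funext => s; have := congr1 (fun h : {ffun S -> K^o} => h s) gp; rewrite !ffunE.
Qed.

Lemma mean_linear a f g : mean (a *: f + g) = a * mean f + mean g.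
Proof.
by rewrite /mean big_split/= mulrDr -mulr_sumr mulrCA.
Qed.

Lemma mean_cst (c : K) (s : S) : mean (fun _ : S => c) = c.
Proof.
rewrite /mean sumr_const cardT -cardE -[c *+ _]mulr_natl mulrA mulVf ?mul1r// pnatr_eq0 -lt0n.
by apply/card_gt0P; exists s.
Qed.

Lemma mean_center f : mean (f - cst (mean f)) = 0.
Proof.
have [s _|S0] := pickP S; last by rewrite /mean big_pred0 ?mulr0.
by rewrite addrC -scaleN1r mean_linear mean_cst// mulN1r addNr.
Qed.

Section Extension.
Variable T : (S -> K) -> (S -> K).
Hypothesis Tl : linear T.
Hypothesis T20 : forall f, L20 K f -> L20 K (T f).

(** Completes the action of [T] on mean-zero functions by the identity on constants, so that
    injectivity on [L20] becomes injectivity on the whole space. *)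
Definition L20_extend f := T (f - cst (mean f)) + cst (mean f).

Lemma L20_extend_linear : linear L20_extend.
Proof.
move=> a f h; rewrite /L20_extend mean_linear.
have -> : (a *: f + h - cst (a * mean f + mean h) : S -> K)
   = a *: (f - cst (mean f)) + (h - cst (mean h)).
  apply/funext => t.
  change (a * f t + h t - (a * mean f + mean h) = a * (f t - mean f) + (h t - mean h)).
  by ring.
rewrite Tl; apply/funext => t.
set u := T _; set w := T _.
change (a * u t + w t + (a * mean f + mean h) = a * (u t + mean f) + (w t + mean h)).
by ring.
Qed.

Lemma L20_extendE f : L20 K f -> L20_extend f = T f.
Proof. by rewrite /L20 /= /L20_extend => f0; rewrite f0 subr0 addr0. Qed.

Lemma mean_extend f : mean (L20_extend f) = mean f.
Proof.
have [s _|S0] := pickP S; last by rewrite /mean !big_pred0.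
rewrite /L20_extend -[T _]scale1r mean_linear (T20 (mean_center f)) mulr0 add0r.
by rewrite mean_cst.
Qed.

Lemma L20_extend_inj : (forall f, L20 K f -> T f = 0 -> f = 0) ->
  forall f, L20_extend f = 0 -> f = 0.
Proof.
move=> Tinj f f0.
have mf : L20 K f by rewrite /L20 /= -mean_extend f0 /mean big1 ?mulr0.
by apply: Tinj => //; rewrite -L20_extendE.
Qed.

Lemma L20_inj_surj : (forall f, L20 K f -> T f = 0 -> f = 0) ->
  forall g, L20 K g -> exists2 f, L20 K f & T f = g.
Proof.
move=> Tinj g g0.
have [f fg] := linear_inj_surj L20_extend_linear (L20_extend_inj Tinj) g.
have f0 : L20 K f by rewrite /L20 /= -mean_extend fg.
by exists f => //; rewrite -L20_extendE.
Qed.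

End Extension.

End LinearMaps.

(** * Coercivity and the Rayleigh quotient *)

Section Rayleigh.
Variables (R : realType) (S : finType).
Implicit Types (f g : S -> R) (T : (S -> R) -> (S -> R)).

Lemma L20_lin a f g : L20 R f -> L20 R g -> L20 R (a *: f + g).
Proof.
by rewrite /L20 /= => f0 g0; rewrite mean_linear f0 g0 mulr0 addr0.
Qed.

Lemma linear_bounded T : linear T ->
  exists2 C, 0 < C & forall f, dot (T f) (T f) <= C * dot f f.
Proof.
move=> Tl; have [C C0 H] := lincomb_bounded (fun s => T (@delta R S s)).
exists C => // f; rewrite {1 2}(delta_expand f) linear_sum //; exact: H.
Qed.

(** The preimages [e s] of the delta functions define the inverse of [T], which [lincomb_bounded]
    bounds. *)
Lemma linear_inj_coercive T : linear T -> (forall f, T f = 0 -> f = 0) ->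
  exists2 C, 0 < C & forall f, dot f f <= C * dot (T f) (T f).
Proof.
move=> Tl Tinj; have surj := linear_inj_surj Tl Tinj.
pose e s := projT1 (cid (surj (@delta R S s))).
have eP s : T (e s) = @delta R S s by rewrite /e; case: cid.
have [C C0 HC] := lincomb_bounded e; exists C => // f.
have {1 2}-> : f = \sum_s T f s *: e s; last exact: HC.
apply/eqP; rewrite -subr_eq0; apply/eqP; apply: Tinj.
have := Tl (-1) (\sum_s T f s *: e s) f; rewrite !scaleN1r => E.
rewrite addrC E linear_sum //.
under eq_bigr do rewrite eP.
by rewrite -delta_expand addNr.
Qed.

Lemma L20_inj_coercive T : linear T -> (forall f, L20 R f -> L20 R (T f)) ->
  (forall f, L20 R f -> T f = 0 -> f = 0) ->
  exists2 C, 0 < C & forall f, L20 R f -> dot f f <= C * dot (T f) (T f).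
Proof.
move=> Tl T20 Tinj.
have [C C0 HC] := linear_inj_coercive (L20_extend_linear Tl)
  (L20_extend_inj T20 Tinj).
by exists C => // f f0; have := HC f; rewrite L20_extendE.
Qed.

(** Nonnegativity of the form at [f - (1 + B)^-1 *: T f] gives
    [dot (T f) (T f) <= (1 + B) * dot (T f) f]; injectivity bounds the left side from below. *)
Lemma psd_inj_coercive T : linear T -> (forall f, L20 R f -> L20 R (T f)) ->
  (forall f g, dot (T f) g = dot f (T g)) ->
  (forall f, L20 R f -> 0 <= dot (T f) f) ->
  (forall f, L20 R f -> T f = 0 -> f = 0) ->
  exists2 c, 0 < c & forall f, L20 R f -> c * dot f f <= dot (T f) f.
Proof.
move=> Tl T20 Tsym Tpos Tinj.
have [C C0 HC] := L20_inj_coercive Tl T20 Tinj.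
have [B B0 HB] := linear_bounded Tl.
exists ((1 + B) * C)^-1; first by rewrite invr_gt0 mulr_gt0// ltr_wpDr// ltW.
move=> f f0; rewrite ler_pdivrMl; last by rewrite mulr_gt0// ltr_wpDr// ltW.
apply: (le_trans (HC _ f0)); rewrite -mulrA mulrCA ler_wpM2l//; first exact: ltW.
have B1 : 0 < 1 + B by rewrite ltr_wpDr// ltW.
have T20f := T20 f f0.
have := Tpos _ (L20_lin (- (1 + B)^-1) T20f f0).
rewrite Tl !dotE (Tsym (T f) f) => H.
have K1 := HB (T f); have := dot_amgm (T (T f)) (T f) ltr01.
rewrite invr1 !mul1r => K2.
have K3 : dot (T (T f)) (T f) <= (1 + B) * dot (T f) (T f).
  have p0 := dot_ge0 (T f); have := mulr_ge0 (ltW B0) p0; lra.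
move: H K3; set q := dot (T (T f)) (T f); set p := dot (T f) (T f).
set r := dot (T f) f => H K3.
have K4 : (1 + B)^-1 * q <= p by rewrite ler_pdivrMl.
have K5 : (1 + B)^-1 * ((1 + B)^-1 * q) <= (1 + B)^-1 * p.
  by rewrite ler_pM2l// invr_gt0.
rewrite -ler_pdivrMl//; lra.
Qed.

(** [lam] is the infimum of the Rayleigh quotient. Were it not an eigenvalue, [T - lam] would be
    nonnegative and injective, hence coercive, and the quotient would exceed [lam] by a fixed
    amount. *)
Lemma rayleigh T : linear T -> (forall f, L20 R f -> L20 R (T f)) ->
  (forall f g, dot (T f) g = dot f (T g)) ->
  (forall f, L20 R f -> 0 <= dot (T f) f) ->
  (exists2 f : S -> R, L20 R f & f != 0) ->
  exists lam : R, smallest_eigenvalue0 T = lam%:E /\ eigenvalues0 T lam /\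
     forall f, L20 R f -> lam * dot f f <= dot (T f) f.
Proof.
move=> Tl T20 Tsym Tpos [f0 f020 f0n].
pose ray f := dot (T f) f / dot f f.
pose A : set R := (ray @` [set f : S -> R | L20 R f /\ f != 0])%classic.
have A0 : (A !=set0)%classic by exists (ray f0), f0.
have Alb : lbound A 0.
  by move=> _ [f [f20 fn] <-]; rewrite /ray divr_ge0 ?Tpos ?dot_ge0.
have Ainf : has_inf A by split => //; exists 0.
pose lam := inf A.
have rayP f : L20 R f -> lam * dot f f <= dot (T f) f.
  move=> f20; have [->|fn] := eqVneq f 0; first by rewrite dot0l mulr0 (dotC (T 0)) dot0l.
  rewrite -ler_pdivlMr ?dot_gt0//; apply: ge_inf; first by exists 0.
  by exists f.
have T0 := linear_zero Tl.
have eig : eigenvalues0 T lam.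
  apply: contrapT => neig.
  pose Q f := T f - lam *: f.
  have Ql : linear Q.
    by move=> a f g; rewrite /Q Tl !scalerDr scalerN !scalerA (mulrC a) opprD addrACA.
  have Q20 f : L20 R f -> L20 R (Q f).
    by move=> f20; rewrite /Q addrC -scaleNr; apply: L20_lin; last exact: T20.
  have [c c0 Hc] : exists2 c, 0 < c & forall f, L20 R f -> c * dot f f <= dot (Q f) f.
    apply: psd_inj_coercive => //.
    - by move=> f g; rewrite /Q !dotE Tsym.
    - by move=> f f20; rewrite /Q !dotE subr_ge0 rayP.
    move=> f f20 /eqP; rewrite subr_eq0 => /eqP Tf; apply: contrapT => fn; apply: neig.
    exists f; split => //; last by move=> s; rewrite Tf.
    apply: contrapT => nz; apply: fn; apply/funext => s.
    by apply/eqP; apply: contrapT => /negP fs; apply: nz; exists s.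
  have : lam + c <= lam.
    apply: lb_le_inf => // _ [f [f20 fn] <-]; rewrite /ray ler_pdivlMr ?dot_gt0//.
    by have := Hc _ f20; rewrite /Q !dotE; lra.
  by rewrite gerDl leNgt c0.
exists lam; split; last by split.
apply/eqP; rewrite eq_le; apply/andP; split.
  by apply: ereal_inf_lbound; exists lam.
apply: le_ereal_inf_tmp => _ [a [f [f20 [s fs] fa]] <-]; rewrite lee_fin.
have fn : f != 0 by apply: contraNneq fs => ->.
have := rayP _ f20; have -> : T f = a *: f by apply/funext => t; exact: fa.
by rewrite dotZl ler_pM2r ?dot_gt0.
Qed.

End Rayleigh.

(** * Transport operators on G * V *)

Section Transport.
Variables (R : realType) (G : finZmodType) (V : {set G}).
Local Notation S := (state V).
Local Notation I := {v : G | v \in V}.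
Local Notation n := (#|V|%:R : R).
Implicit Types (f h : S -> R) (u w : G -> R).

Fact transport_key : unit. Proof. exact: tt. Qed.

(* Locked, so that rewriting with the linearity of [dot] does not unfold them. *)
Definition pull := locked_with transport_key (fun (u : G -> R) (s : S) => u s.1).
Definition vavg := locked_with transport_key
  (fun (f : S -> R) (x : G) => n^-1 * \sum_(w : I) f (x, w)).
Definition fwd := locked_with transport_key
  (fun (f : S -> R) (s : S) => f (s.1 + val s.2, s.2) - f s).
Definition bwd := locked_with transport_key
  (fun (f : S -> R) (s : S) => f (s.1 - val s.2, s.2) - f s).
Definition lapl := locked_with transport_key (fun (u : G -> R) (x : G) => - laplacian V u x).

Lemma pullE u s : pull u s = u s.1.
Proof. by rewrite /pull unlock. Qed.

Lemma vavgE f x : vavg f x = n^-1 * \sum_(w : I) f (x, w).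
Proof. by rewrite /vavg unlock. Qed.

Lemma fwdE f s : fwd f s = f (s.1 + val s.2, s.2) - f s.
Proof. by rewrite /fwd unlock. Qed.

Lemma bwdE f s : bwd f s = f (s.1 - val s.2, s.2) - f s.
Proof. by rewrite /bwd unlock. Qed.

Lemma lapl_laplacian u x : lapl u x = - laplacian V u x.
Proof. by rewrite /lapl unlock. Qed.

Lemma dot_state f h : dot f h = \sum_(v : I) \sum_(x : G) f (x, v) * h (x, v).
Proof.
rewrite exchange_big /= /dot (eq_bigl (fun=> true))// pair_bigA /=.
by apply: eq_bigr => -[x v] _.
Qed.

Lemma shift_sum (F : G -> R) v : \sum_x F (x + v) = \sum_x F x.
Proof.
by rewrite [RHS](reindex_inj (addIr v)).
Qed.

Lemma fwd_linear : linear fwd.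
Proof.
move=> a f h; apply/funext => s; rewrite fwdE -[RHS]/(a * fwd f s + fwd h s) !fwdE.
change (a * f (s.1 + val s.2, s.2) + h (s.1 + val s.2, s.2) - (a * f s + h s)
  = a * (f (s.1 + val s.2, s.2) - f s) + (h (s.1 + val s.2, s.2) - h s)).
by ring.
Qed.

Lemma vavg_linear : linear vavg.
Proof.
move=> a f h; apply/funext => x; rewrite -[RHS]/(a * vavg f x + vavg h x) !vavgE.
by rewrite big_split /= mulrDr -mulr_sumr mulrCA.
Qed.

Lemma pull_linear : linear pull.
Proof.
by move=> a u w; apply/funext => s; rewrite -[RHS]/(a * pull u s + pull w s) !pullE.
Qed.

Lemma lapl_linear : linear lapl.
Proof.
move=> a u w; apply/funext => x.
rewrite -[RHS]/(a * lapl u x + lapl w x) !lapl_laplacian /laplacian.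
have -> : \sum_(v in V) ((a *: u + w) (x + v) - 2 * (a *: u + w) x + (a *: u + w) (x - v))
  = a * \sum_(v in V) (u (x + v) - 2 * u x + u (x - v))
    + \sum_(v in V) (w (x + v) - 2 * w x + w (x - v)).
  rewrite mulr_sumr -big_split /=; apply: eq_bigr => v _.
  change (a * u (x + v) + w (x + v) - 2 * (a * u x + w x) + (a * u (x - v) + w (x - v))
    = a * (u (x + v) - 2 * u x + u (x - v)) + (w (x + v) - 2 * w x + w (x - v))).
  by ring.
by ring.
Qed.

Lemma dot_fwd f h : dot (fwd f) h = dot f (bwd h).
Proof.
rewrite !dot_state; apply: eq_bigr => v _.
under eq_bigr do rewrite fwdE.
under [RHS]eq_bigr do rewrite bwdE /=.
under eq_bigr do rewrite mulrBl.
under [RHS]eq_bigr do rewrite mulrBr.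
rewrite !big_split /= !sumrN; congr (_ - _).
rewrite -(shift_sum _ (- val v)); apply: eq_bigr => x _; by rewrite subrK.
Qed.

Lemma fwd_bwd f : fwd (bwd f) = - (fwd f + bwd f).
Proof.
apply/funext => -[x v]; rewrite -[RHS]/(- (fwd f (x, v) + bwd f (x, v))).
by rewrite !(fwdE, bwdE) /= addrK; ring.
Qed.

Lemma bwd_fwd f : bwd (fwd f) = - (fwd f + bwd f).
Proof.
apply/funext => -[x v]; rewrite -[RHS]/(- (fwd f (x, v) + bwd f (x, v))).
by rewrite !(fwdE, bwdE) /= subrK; ring.
Qed.

(** Translation is an isometry, so the squared norm of an increment is twice the loss of
    correlation. *)
Lemma dot_fwd_self f : dot (fwd f) (fwd f) = - (2 * dot (fwd f) f).
Proof.
by rewrite {1}dot_fwd bwd_fwd dotNr dotDr -dot_fwd (dotC f); ring.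
Qed.

Lemma dot_bwd_self f : dot (bwd f) (bwd f) = dot (fwd f) (fwd f).
Proof. 
by rewrite -dot_fwd fwd_bwd dot_fwd_self dotNl dotDl (dotC (bwd f)) -dot_fwd; ring. Qed.

Lemma dot_fwd_le f : dot (fwd f) (fwd f) <= 4 * dot f f.
Proof.
have := dot_fwd_self f; have := dot_ge0 (fwd f + 2%:R *: f).
rewrite !dotE (dotC f) => H K; lra.
Qed.

(** Up to the factor [n], averaging over velocities is the adjoint of [pull]. *)
Lemma dot_pull u f : dot (pull u) f = n * dot u (vavg f).
Proof.
rewrite dot_state exchange_big /= mulr_sumr; apply: eq_bigr => x _.
under eq_bigr do rewrite pullE /=.
rewrite vavgE -mulr_sumr.
(* For empty [V] the state space is empty, and both sides vanish. *)
have [V0|V0] := eqVneq n 0.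
  rewrite V0 mul0r big1 ?mulr0// => v _; exfalso.
  have : (0 < #|V|)%N by apply/card_gt0P; exists (val v); exact: (valP v).
  by move/eqP : V0; rewrite pnatr_eq0 => /eqP ->.
by rewrite (mulrCA (u x)) mulVKf.
Qed.

Lemma vavg_pull u : (0 < #|V|)%N -> vavg (pull u) = u.
Proof.
move=> V0; apply/funext => x; rewrite vavgE.
under eq_bigr do rewrite pullE /=.
rewrite sumr_const.
have -> : #|{: I}| = #|V| by rewrite card_sig; apply: eq_card.
by rewrite -[u x *+ _]mulr_natl mulrA mulVf ?mul1r // pnatr_eq0 -lt0n.
Qed.

Hypothesis Vsym : symmetric_generators V.

Lemma sum_opp (F : G -> R) : \sum_(v in V) F (- v) = \sum_(v in V) F v.
Proof.
have [VN _] := Vsym; rewrite [RHS](reindex_inj oppr_inj) /=; apply: eq_bigl => v.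
rewrite {2}VN; apply/idP/imsetP; first by exists v.
by move=> [w wV /oppr_inj ->].
Qed.

(** Symmetry of [V] makes the forward and backward halves equal, which cancels the factor 1/2 in
    [laplacian]. *)
Lemma laplE u x : lapl u x = \sum_(v : I) (u x - u (x + val v)).
Proof.
rewrite lapl_laplacian /laplacian.
rewrite -(big_sub (mem V) (fun v => u x - u (x + v))).
have -> : \sum_(v in V) (u (x + v) - 2 * u x + u (x - v))
   = \sum_(v in V) (u (x + v) - u x) + \sum_(v in V) (u (x - v) - u x).
  by rewrite -big_split; apply: eq_bigr => v _ /=; ring.
rewrite (sum_opp (fun v => u (x + v) - u x)).
have -> : \sum_(v in V) (u x - u (x + v)) = - \sum_(v in V) (u (x + v) - u x).
  by rewrite -sumrN; apply: eq_bigr => v _; ring.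
by field.
Qed.

Lemma lapl_bwdE u x : lapl u x = \sum_(v : I) (u x - u (x - val v)).
Proof.
rewrite laplE -(big_sub (mem V) (fun v => u x - u (x + v))).
by rewrite -(sum_opp (fun v => u x - u (x + v))) (big_sub (mem V) (fun v => u x - u (x - v))).
Qed.

(** The link between the walk and the Laplacian: for a function of the position, the drift averaged
    over the velocities is [Delta / n]. *)
Lemma vavg_fwd_pull u : vavg (fwd (pull u)) = - (n^-1 *: lapl u).
Proof.
apply/funext => x; rewrite -[RHS]/(- (n^-1 * lapl u x)) vavgE laplE -mulrN -sumrN.
by congr (_ * _); apply: eq_bigr => v _; rewrite fwdE !pullE opprB.
Qed.

Lemma vavg_bwd_pull u : vavg (bwd (pull u)) = - (n^-1 *: lapl u).
Proof.
apply/funext => x; rewrite -[RHS]/(- (n^-1 * lapl u x)) vavgE lapl_bwdE -mulrN -sumrN.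
by congr (_ * _); apply: eq_bigr => v _; rewrite bwdE !pullE opprB.
Qed.

Hypothesis V0 : (0 < #|V|)%N.
Let n0 : n != 0. Proof. by rewrite pnatr_eq0 -lt0n. Qed.

Lemma lapl_sym u w : dot (lapl u) w = dot u (lapl w).
Proof.
have := dot_fwd (pull u) (pull w); rewrite dotC !dot_pull vavg_fwd_pull vavg_bwd_pull.
rewrite !dotE -!mulrN => /(mulfI n0)/(mulfI (invr_neq0 n0)).
by move=> H; apply: oppr_inj; rewrite (dotC (lapl u)).
Qed.

Lemma dot_fwd_pull u w : dot (fwd (pull u)) (fwd (pull w)) = 2 * dot (lapl u) w.
Proof.
rewrite dot_fwd bwd_fwd dotNr dotDr !dot_pull vavg_fwd_pull vavg_bwd_pull.
by rewrite !dotE -lapl_sym; field.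
Qed.

Lemma dot_bwd_pull u : dot (bwd (pull u)) (bwd (pull u)) = 2 * dot (lapl u) u.
Proof. by rewrite dot_bwd_self dot_fwd_pull. Qed.

Lemma lapl_ge0 u : 0 <= dot (lapl u) u.
Proof. by have := dot_ge0 (fwd (pull u)); rewrite dot_fwd_pull; lra. Qed.

Lemma lapl_L20 u : L20 R (lapl u).
Proof.
rewrite /L20 /= /mean; under eq_bigr do rewrite laplE.
rewrite exchange_big big1 ?mulr0 //= => v _.
by rewrite big_split /= sumrN (shift_sum u) subrr.
Qed.

(** Minus the usual second difference: with this sign the operator is nonnegative. *)
Definition snd_diff (v : I) u : G -> R := fun x => 2 * u x - u (x + val v) - u (x - val v).

Lemma bwd_fwd_pull u (v : I) x : bwd (fwd (pull u)) (x, v) = snd_diff v u x.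
Proof. 
rewrite bwd_fwd -[LHS]/(- (fwd (pull u) (x, v) + bwd (pull u) (x, v))).
rewrite fwdE bwdE !pullE /snd_diff /=.
by ring.
 Qed.

Lemma two_lapl u : 2%:R *: lapl u = \sum_(v : I) snd_diff v u.
Proof.
apply/funext => x; rewrite fct_sumE -[LHS]/(2 * lapl u x).
rewrite mulrDl mul1r {1}laplE lapl_bwdE -big_split; apply: eq_bigr => v _.
by rewrite /snd_diff /=; ring.
Qed.

Definition fst_diff (v : I) u : G -> R := fun x => u (x + val v) - u x.

Lemma dot_snd_diff v u w : dot (snd_diff v u) w = dot (fst_diff v u) (fst_diff v w).
Proof.
rewrite /dot /snd_diff /fst_diff.
under eq_bigr do rewrite !mulrBl.
under [RHS]eq_bigr do rewrite mulrBr !mulrBl opprB.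
rewrite !big_split /= !sumrN.
have -> : \sum_x u (x + val v) * w (x + val v) = \sum_x u x * w x.
  exact: (shift_sum (fun x => u x * w x)).
have -> : \sum_x u (x - val v) * w x = \sum_x u x * w (x + val v).
  rewrite -(shift_sum _ (val v)); apply: eq_bigr => x _; by rewrite addrK.
under eq_bigr do rewrite -mulrA.
by rewrite -mulr_sumr; ring.
Qed.

Lemma fst_diff_snd_diff (v w : I) u : fst_diff v (snd_diff w u) = snd_diff w (fst_diff v u).
Proof.
apply/funext => x; rewrite /fst_diff /snd_diff !(addrAC x (val v)); ring.
Qed.

(** Differences on an abelian group commute, so two summations by parts turn the product into the
    squared norm of a mixed first difference. *)
Lemma snd_diff_snd_diff_ge0 (v w : I) u : 0 <= dot (snd_diff v u) (snd_diff w u).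
Proof. by rewrite dot_snd_diff fst_diff_snd_diff dotC dot_snd_diff dot_ge0. Qed.

(** Expanding the squared norm of the sum of the [snd_diff v u], which is [2%:R *: lapl u], gives
    the left side as the diagonal; the off-diagonal terms are nonnegative. No factor [n] is lost. *)
Lemma dot_bwd_fwd_pull u :
  dot (bwd (fwd (pull u))) (bwd (fwd (pull u))) <= 4 * dot (lapl u) (lapl u).
Proof.
have -> : 4 * dot (lapl u) (lapl u) = dot (2%:R *: lapl u) (2%:R *: lapl u).
  by rewrite !dotE; ring.
have sum_dotl (F : I -> G -> R) (h : G -> R) : dot (\sum_v F v) h = \sum_v dot (F v) h.
  by elim/big_rec2: _ => [|v y1 y2 _ <-]; rewrite ?dot0l ?dotDl.
rewrite two_lapl sum_dotl dot_state; apply: ler_sum => v _.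
have -> : \sum_x bwd (fwd (pull u)) (x, v) * bwd (fwd (pull u)) (x, v)
    = dot (snd_diff v u) (snd_diff v u).
  by apply: eq_bigr => x _; rewrite bwd_fwd_pull.
rewrite [leRHS]dotC sum_dotl (bigD1 v) //= lerDl; apply: sumr_ge0 => w _.
exact: snd_diff_snd_diff_ge0.
Qed.

(** The Dirichlet form vanishes, so each [v] in [V] is a period of [u]. The periods form a subgroup,
    which contains the generators and hence is [G]. *)
Lemma fwd_pull_const u : lapl u = 0 -> forall x y, u x = u y.
Proof.
move=> u0.
have H : fwd (pull u) = 0 by apply: dot_eq0; rewrite dot_fwd_pull u0 dot0l mulr0.
have H1 v x : v \in V -> u (x + v) = u x.
  move=> vV; have := congr1 (@^~ (x, exist _ v vV)) H.
  by move=> /eqP; rewrite fwdE !pullE /= subr_eq0 => /eqP.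
have [_ gen] := Vsym.
have stab : group_set [set g : G | [forall x, u (x + g) == u x]].
  apply/group_setP; split.
    by rewrite inE; apply/forallP => x; rewrite addr0.
  move=> a b; rewrite !inE => /forallP Ha /forallP Hb; apply/forallP => x.
  by rewrite -[(a * b)%g]/(a + b) addrA (eqP (Hb _)) (eqP (Ha _)).
have : (<<V>> \subset Group stab)%g.
  rewrite gen_subG; apply/fintype.subsetP => v vV; rewrite inE; apply/forallP => x.
  by rewrite H1.
rewrite gen => /fintype.subsetP sub x y.
have := sub (x - y); rewrite inE => /(_ isT); rewrite inE => /forallP/(_ y)/eqP.
by rewrite addrC subrK.
Qed.

Lemma lapl_inj u : L20 R u -> lapl u = 0 -> u = 0.
Proof.
move=> u0 /fwd_pull_const uc; apply/funext => x.
have uE : u = fun=> u x by apply/funext => y; exact: uc.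
by move: u0; rewrite /L20 /= uE (mean_cst _ x).
Qed.

End Transport.

(** * Dissipation and coercivity of the generator *)

Section Dissipation.
Variables (R : realType) (G : finZmodType) (V : {set G}) (gamma : R).
Local Notation S := (state V).
Local Notation n := (#|V|%:R : R).
Local Notation L := (lifted_gen V gamma).
Implicit Types (f h : S -> R) (u w : G -> R).
Hypothesis Vsym : symmetric_generators V.
Hypothesis V0 : (0 < #|V|)%N.
Hypothesis gamma0 : 0 < gamma.

Definition fluct := locked_with transport_key (fun f : S -> R => f - pull (vavg f)).

Lemma fluctE f : fluct f = f - pull (vavg f).
Proof. by rewrite /fluct unlock. Qed.

Let n1 : 1 <= n. Proof. by rewrite (ler_nat R 1). Qed.
Let n0 : n != 0. Proof. by rewrite gt_eqF// (lt_le_trans ltr01). Qed.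

Lemma lifted_genE f : L f = fwd f - gamma *: fluct f.
Proof.
apply/funext => -[x v].
rewrite -[RHS]/(fwd f (x, v) - gamma * fluct f (x, v)).
rewrite fluctE fwdE -[(f - _) _]/(f (x, v) - pull (vavg f) (x, v)) pullE vavgE.
by rewrite /lifted_gen /refresh /=; ring.
Qed.

Lemma lifted_gen_linear : linear L.
Proof.
move=> a f h; rewrite !lifted_genE !fluctE fwd_linear vavg_linear pull_linear.
move: (fwd f) (fwd h) (pull (vavg f)) (pull (vavg h)) => F1 F2 P1 P2.
apply/funext => s.
change (a * F1 s + F2 s - gamma * (a * f s + h s - (a * P1 s + P2 s))
  = a * (F1 s - gamma * (f s - P1 s)) + (F2 s - gamma * (h s - P2 s))).
by ring.
Qed.

Lemma split_fluct f : f = pull (vavg f) + fluct f.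
Proof. by rewrite fluctE addrC subrK. Qed.

Lemma vavg_fluct f : vavg (fluct f) = 0.
Proof.
rewrite fluctE addrC -scaleN1r (vavg_linear _ _ f) (vavg_pull _ V0).
by rewrite scaleN1r addNr.
Qed.

Lemma dot_pull_fluct u f : dot (pull u) (fluct f) = 0.
Proof. by rewrite dot_pull vavg_fluct dotC dot0l mulr0. Qed.

Lemma dot_pull_pull u w : dot (pull u : S -> R) (pull w) = n * dot u w.
Proof. by rewrite dot_pull vavg_pull. Qed.

Lemma dot_split f : dot f f = n * dot (vavg f) (vavg f) + dot (fluct f) (fluct f).
Proof.
rewrite {1 2}(split_fluct f) dotDl !dotDr dot_pull_pull (dotC (fluct f) (pull _)).
by rewrite dot_pull_fluct addr0 add0r.
Qed.

Lemma dot_fluct f : dot (fluct f) f = dot (fluct f) (fluct f).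
Proof. by rewrite {2}(split_fluct f) dotDr dotC dot_pull_fluct add0r. Qed.

Lemma vavg_L20 f : L20 R f -> L20 R (vavg f).
Proof.
rewrite /L20 /= /mean => /eqP f0; apply/eqP; move: f0; rewrite !mulf_eq0 !invr_eq0.
have -> : \sum_s f s = n * \sum_x vavg f x.
  have := dot_pull (fun=> 1) f; rewrite /dot.
  under eq_bigr do rewrite pullE mul1r.
  by under [in RHS]eq_bigr do rewrite mul1r.
rewrite card_prod natrM !mulf_eq0 (negbTE n0) /= => /orP[/orP[->//|]|->]; last by rewrite orbT.
have -> : #|{: {v : G | v \in V}}| = #|V| by rewrite card_sig; apply: eq_card.
by rewrite (negbTE n0).
Qed.

(** Half the squared norm of [fwd f], by [dot_fwd_self]. *)
Definition dissipation f := - dot (fwd f) f.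

Lemma dissipation_ge0 f : 0 <= dissipation f.
Proof. by have := dot_ge0 (fwd f); rewrite dot_fwd_self /dissipation; lra. Qed.

Lemma dot_lifted_gen f : dot (L f) f = - (dissipation f + gamma * dot (fluct f) (fluct f)).
Proof. by rewrite lifted_genE dotDl dotNl dotZl dot_fluct /dissipation; ring. Qed.

Lemma fwd_split f : fwd f = fwd (pull (vavg f)) + fwd (fluct f).
Proof. by rewrite {1}(split_fluct f) -[X in X + _]scale1r fwd_linear scale1r. Qed.

(** The increment of the average is [fwd f - fwd (fluct f)]; the first part costs dissipation, and
    on the second [fwd] has norm at most 2. *)
Lemma lapl_diss f :
  dot (lapl V (vavg f)) (vavg f) <= 2 * dissipation f + 4 * dot (fluct f) (fluct f).
Proof.
have E : fwd (pull (vavg f)) = fwd f - fwd (fluct f) by rewrite (fwd_split f) addrK.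
have := dot_fwd_pull Vsym V0 (vavg f) (vavg f); rewrite E !dotE (dotC (fwd (fluct f))).
have := dot_amgmN (fwd f) (fwd (fluct f)) ltr01; rewrite invr1 !mul1r.
have := dot_fwd_self f; have := dot_fwd_le (fluct f); rewrite /dissipation => H1 H2 H3 H4.
lra.
Qed.

(** Invariance of the uniform measure: transport and refreshment both have range orthogonal to the
    constants. *)
Lemma L20_lifted_gen f : L20 R (L f).
Proof.
have c0 : dot (fun=> 1) (L f) = 0.
  have -> : (fun=> 1) = pull (fun=> 1 : R) :> (S -> R) by apply/funext => s; rewrite pullE.
  rewrite lifted_genE dotDr dotNr dotZr dot_pull_fluct mulr0 subr0.
  have <- : dot (fwd f) (pull (fun=> 1)) = 0; last exact: dotC.
  rewrite dot_fwd /dot big1// => s _; by rewrite bwdE !pullE subrr mulr0.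
move: c0; rewrite /dot /L20 /= /mean; under eq_bigr do rewrite mul1r.
by move=> ->; rewrite mulr0.
Qed.

(** * Norm bound for the inverse of the generator *)

Section Static.
Variable lam : R.
Hypothesis lam0 : 0 < lam.
Hypothesis poincare : forall u, L20 R u -> lam * dot u u <= dot (lapl V u) u.

Lemma vavg_control f : L20 R f ->
  lam * dot (vavg f) (vavg f) <=
    2 * lam * dot (fluct f) (fluct f) + 2 * dot (L f) (L f)
    + 2 * gamma ^+ 2 * dot (fluct f) (fluct f).
Proof.
move=> f0; have m0 := vavg_L20 f0.
have [u u0 um] := L20_inj_surj (@lapl_linear R G V) (fun w _ => lapl_L20 Vsym w)
  (lapl_inj Vsym V0) m0.
set m := vavg f in um *; set b := fluct f.
have Z : lam * dot m u <= dot m m.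
  have := poincare u0; rewrite um => P.
  have := dot_amgm u m lam0; rewrite (dotC u m) => A.
  have : dot m u <= lam^-1 * dot m m by lra.
  by rewrite ler_pdivlMl.
(* The generator equation is paired with [fwd (pull u)]; as [lapl V u = m], the transported average
   contributes [2 * dot m m]. *)
have E : 4 * dot m m = 2 * dot (L f) (fwd (pull u)) - 2 * dot b (bwd (fwd (pull u)))
    + 2 * (gamma * dot b (fwd (pull u))).
  have -> : 4 * dot m m = 2 * dot (fwd (pull m)) (fwd (pull u) : S -> R).
    by rewrite dotC (dot_fwd_pull Vsym V0) um; ring.
  rewrite -dot_fwd lifted_genE (fwd_split f) -/m -/b !dotE; ring.
(* The weights are chosen so that the three terms on the right contain [dot m m] with coefficients
   1, 1/2 and 1/2, leaving 2 of the 4 on the left. *)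
have e1 := dot_amgmN b (bwd (fwd (pull u))) (ltr0n R 4 : 0 < 4%:R).
have := dot_bwd_fwd_pull Vsym u; rewrite um => e1'.
have k2 : 0 < 4 / lam by rewrite divr_gt0.
have := dot_amgm (L f) (fwd (pull u)) k2.
rewrite invf_div (dot_fwd_pull Vsym V0) um => e2.
have k3 : 0 < 4 * gamma / lam by rewrite !(divr_gt0, mulr_gt0).
have := dot_amgm b (fwd (pull u)) k3; rewrite -(ler_pM2l gamma0).
rewrite invf_div (dot_fwd_pull Vsym V0) um => e3.
have e2' : lam * (2 * dot (L f) (fwd (pull u))) <= 4 * dot (L f) (L f) + lam / 2 * dot m m.
  move: e2; rewrite -(ler_pM2l lam0) => /le_trans; apply.
  rewrite mulrDr mulrA mulrCA divff ?gt_eqF// mulr1 lerD2l.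
  have -> : lam * (lam / 4 * (2 * dot m u)) = lam / 2 * (lam * dot m u) by field.
  by rewrite ler_pM2l// divr_gt0.
have e3' : lam * (2 * (gamma * dot b (fwd (pull u)))) <=
    4 * gamma ^+ 2 * dot b b + lam / 2 * dot m m.
  rewrite (mulrCA 2); move: e3; rewrite -(ler_pM2l lam0) => /le_trans; apply.
  have -> : lam * (gamma * (4 * gamma / lam * dot b b
      + lam / (4 * gamma) * (2 * dot m u)))
    = 4 * gamma ^+ 2 * dot b b + lam / 2 * (lam * dot m u).
    by field; rewrite !gt_eqF.
  by rewrite lerD2l ler_pM2l// divr_gt0.
have e1'' : lam * - (2 * dot b (bwd (fwd (pull u)))) <= lam * (4 * dot b b + dot m m).
  by rewrite ler_pM2l//; apply: (le_trans e1); lra.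
have := congr1 ( *%R lam) E; lra.
Qed.

Lemma lifted_gen_coercive M : n * Num.min 1 gamma / lam <= M -> (1 + 2 * n) / gamma <= M ->
  forall f, L20 R f -> dot f f <= 64 * M ^+ 2 * dot (L f) (L f).
Proof.
move=> M1 M2 f f0.
have M0 : 0 < M by apply: lt_le_trans M2; rewrite divr_gt0//; have := n1; lra.
have p0 := dissipation_ge0 f; have q0 := dot_ge0 (fluct f); have m0 := dot_ge0 (vavg f).
have h0 := dot_ge0 (L f).
have D := dot_lifted_gen f; have N := dot_split f.
set p := dissipation f in p0 D *; set q := dot (fluct f) _ in q0 D N *.
set mm := dot (vavg f) _ in m0 N *; set eta := dot (L f) (L f) in h0 *.
have K2 : (1 + 2 * n) * q <= M * (gamma * q).
  by rewrite mulrA ler_wpM2r// -ler_pdivrMr.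
have Mp : 0 <= M * p by rewrite mulr_ge0// ltW.
have Mq : 0 <= M * (gamma * q) by rewrite !mulr_ge0// ltW.
have Me : 0 <= M * (M * eta) by rewrite !mulr_ge0// ltW.
have nq : q <= n * q by rewrite ler_peMl.
(* Since [p + gamma * q] is [- dot (L f) f], the weight [5 * M] absorbs half of [dot f f] and leaves
   [29 * M ^+ 2 * eta], within the allowed 64. *)
suff : dot f f <= 5 * M * (p + gamma * q) + 2 * M ^+ 2 * eta.
  move=> H; have k0 : 0 < 5 * M by rewrite mulr_gt0.
  have := dot_amgmN (L f) f k0; rewrite -(ler_pM2l k0) D -/eta mulrDr (mulVKf (lt0r_neq0 k0)).
  by move=> H'; lra.
(* Strong refreshment: Poincare and [lapl_diss] bound the average by the dissipated energy. *)
have [g1|g1] := leP 1 gamma.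
  rewrite min_l// mulr1 ler_pdivrMr// in M1.
  have P := poincare (vavg_L20 f0); have Y := lapl_diss f.
  rewrite -/mm -/p -/q in P Y.
  have H1 : n * mm <= M * lam * mm by rewrite ler_wpM2r.
  have H2 : M * lam * mm <= M * (2 * p + 4 * q).
    by rewrite -mulrA ler_pM2l//; lra.
  have H3 : M * q <= M * (gamma * q) by rewrite ler_pM2l// ler_peMl.
  by rewrite N; lra.
(* Weak refreshment: [n / lam] is at most [M * M], because [n * gamma / lam] and [gamma^-1] are at
   most [M]. The [2 * n * q] from [vavg_control] and the [q] from [dot_split] account for
   [1 + 2 * n]. *)
have {}M1 : n * gamma / lam <= M by move: M1; rewrite min_r// ltW.
have H := vavg_control f0; rewrite -/mm -/q -/eta in H.
pose mu := n / lam.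
have mu0 : 0 <= mu by rewrite divr_ge0// ltW.
have mug : mu * gamma <= M by rewrite /mu mulrAC.
have nE : n = mu * lam by rewrite /mu divfK// gt_eqF.
have gi : gamma^-1 <= M.
  apply: le_trans M2; rewrite -[leLHS]mul1r ler_pM2r ?invr_gt0//; have := n1; lra.
have muM : mu <= M * M.
  apply: (@le_trans _ _ (M * gamma^-1)); last by rewrite ler_pM2l.
  by rewrite ler_pdivlMr.
have H1 : n * mm <= 2 * n * q + 2 * (mu * eta) + 2 * (mu * gamma) * (gamma * q).
  rewrite nE -mulrA; apply: (le_trans (ler_wpM2l mu0 H)).
  by rewrite le_eqVlt; apply/orP; left; apply/eqP; ring.
have H2 : mu * eta <= M * M * eta by rewrite ler_wpM2r.
have H3 : mu * gamma * (gamma * q) <= M * (gamma * q) by rewrite ler_wpM2r// mulr_ge0// ltW.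
by rewrite N; lra.
Qed.

End Static.
End Dissipation.

(** * Lyapunov form *)

(** Along the semigroup, [B f f] has time derivative [2 * B (L f) f], so the last clause is
    exponential decay at rate [r]. *)
Definition lyapunov (R : realType) (S : finType) (L : (S -> R) -> S -> R) (r : R)
    (B : (S -> R) -> (S -> R) -> R) : Prop :=
  [/\ forall a f g h, B (a *: f + g) h = a * B f h + B g h,
      forall f g, B f g = B g f,
      forall f, 4^-1 * dot f f <= B f f <= dot f f &
      forall f, L20 R f -> 2 * B (L f) f <= - r * B f f].

Section Lyapunov.
Variables (R : realType) (G : finZmodType) (V : {set G}) (gamma : R).
Local Notation S := (state V).
Local Notation n := (#|V|%:R : R).
Local Notation L := (lifted_gen V gamma).
Implicit Types (f h : S -> R) (u w : G -> R).
Hypothesis Vsym : symmetric_generators V.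
Hypothesis V0 : (0 < #|V|)%N.
Hypothesis gamma0 : 0 < gamma.

Let n1 : 1 <= n. Proof. by rewrite (ler_nat R 1). Qed.
Let n0 : n != 0. Proof. by rewrite gt_eqF// (lt_le_trans ltr01). Qed.
Let g0 : gamma != 0. Proof. by rewrite gt_eqF. Qed.

(** For [gamma] at least 1 refreshment dominates the fluctuation, and [lapl_diss] then converts the
    dissipation into control of the average. *)
Lemma lyapunov_large lam r : 0 < lam ->
  (forall u, L20 R u -> lam * dot u u <= dot (lapl V u) u) ->
  1 <= gamma -> 0 <= r -> 8 * n * r <= lam -> 8 * n * r <= gamma ->
  lyapunov L r (fun f g => 2^-1 * dot f g).
Proof.
move=> lam0 poincare g1 r0 r1 r2; split.
- by move=> a f g h; rewrite dotDl dotZl; ring.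
- by move=> f g; rewrite dotC.
- by move=> f; have := dot_ge0 f => H; apply/andP; split; lra.
move=> f f0.
have p0 := dissipation_ge0 f; have q0 := dot_ge0 (fluct f); have m0 := dot_ge0 (vavg f).
have D := dot_lifted_gen gamma V0 f; have N := dot_split V0 f.
have P := poincare _ (vavg_L20 V0 f0); have Y := lapl_diss Vsym V0 f.
have H1 : 8 * n * r * dot (vavg f) (vavg f) <= lam * dot (vavg f) (vavg f).
  by rewrite ler_wpM2r.
have r3 : r <= n * r by rewrite ler_peMl.
have H2 : 8 * r * dot (fluct f) (fluct f) <= gamma * dot (fluct f) (fluct f).
  by rewrite ler_wpM2r//; lra.
have H3 : dot (fluct f) (fluct f) <= gamma * dot (fluct f) (fluct f).
  by rewrite ler_peMl.
rewrite D N; lra.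
Qed.

Lemma dot_bwd_le f : dot (bwd f) (bwd f) <= 4 * dot f f.
Proof. by rewrite dot_bwd_self dot_fwd_le. Qed.

Definition shifted u : G -> R := gamma ^+ 2 *: u + lapl V u.

Lemma shifted_linear : linear shifted.
Proof.
move=> a u w; rewrite /shifted lapl_linear; apply/funext => x.
move: (lapl V u) (lapl V w) => U W.
change (gamma ^+ 2 * (a * u x + w x) + (a * U x + W x) =
  a * (gamma ^+ 2 * u x + U x) + (gamma ^+ 2 * w x + W x)).
by ring.
Qed.

Lemma shifted_inj u : shifted u = 0 -> u = 0.
Proof.
move=> u0; have := congr1 (dot u) u0; rewrite /shifted [in RHS]dotC dot0l dotDr dotZr.
rewrite (dotC u (lapl V u)) => H; apply: dot_eq0; apply/eqP.
rewrite eq_le dot_ge0 andbT.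
have g2 : 0 < gamma ^+ 2 by rewrite exprn_gt0.
by rewrite -(pmulr_rle0 _ g2); have := lapl_ge0 Vsym V0 u; lra.
Qed.

Definition resolvent w : G -> R :=
  projT1 (cid (linear_inj_surj shifted_linear shifted_inj w)).

Lemma resolventK w : shifted (resolvent w) = w.
Proof. by rewrite /resolvent; case: cid. Qed.

Lemma shifted_cancel u w : shifted u = shifted w -> u = w.
Proof.
move=> uw; apply/eqP; rewrite -subr_eq0; apply/eqP; apply: shifted_inj.
have := shifted_linear (-1) w u; rewrite !scaleN1r uw addNr => <-.
by rewrite addrC.
Qed.

Lemma resolvent_linear : linear resolvent.
Proof.
by move=> a u w; apply: shifted_cancel; rewrite shifted_linear !resolventK.
Qed.

(* 40 is large enough for all error terms in [cross_gen] to be absorbed. *)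
Definition corrector f : G -> R := resolvent ((gamma / 40) *: vavg f).

Lemma corrector_linear : linear corrector.
Proof.
move=> a f h; rewrite /corrector -resolvent_linear; congr resolvent.
by rewrite vavg_linear scalerDr !scalerA (mulrC a).
Qed.

Definition cross f h : R := dot (fwd (pull (corrector f))) (fluct h).

Lemma cross_linl a f g h : cross (a *: f + g) h = a * cross f h + cross g h.
Proof. by rewrite /cross corrector_linear pull_linear fwd_linear dotDl dotZl. Qed.

Lemma fluct_linear : linear (@fluct R G V).
Proof.
move=> a f h; rewrite !fluctE vavg_linear pull_linear.
move: (pull (vavg f)) (pull (vavg h)) => P1 P2; apply/funext => s.
change (a * f s + h s - (a * P1 s + P2 s) = a * (f s - P1 s) + (h s - P2 s)).
by ring.
Qed.

Lemma cross_linr a f g h : cross h (a *: f + g) = a * cross h f + cross h g.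
Proof. by rewrite /cross fluct_linear dotDr dotZr. Qed.

(** Symmetrised; on the diagonal it is [2^-1 * dot f f - cross f f]. *)
Definition modified f h : R := 2^-1 * (dot f h - (cross f h + cross h f)).

Lemma corrector_eq f :
  gamma ^+ 2 *: corrector f + lapl V (corrector f) = (gamma / 40) *: vavg f.
Proof. exact: resolventK. Qed.

(** Pairing the corrector equation with [u] bounds the Dirichlet form of [u] by [6400^-1 * dot m m];
    the weight [80 * gamma] is the one for which [gamma ^+ 2 * dot u u] cancels. *)
Lemma cross_small f : `|cross f f| <= 4^-1 * dot f f.
Proof.
set u := corrector f; set m := vavg f.
have E : dot u (gamma ^+ 2 *: u + lapl V u) = dot u ((gamma / 40) *: m).
  by rewrite corrector_eq.
rewrite dotDr !dotZr (dotC u (lapl V u)) in E.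
have g3 : 0 < 80 * gamma by rewrite mulr_gt0.
have A := dot_amgm u m g3.
have A' : gamma / 40 * dot u m <= gamma ^+ 2 * dot u u + 6400^-1 * dot m m.
  have -> : gamma / 40 * dot u m = gamma / 80 * (2 * dot u m) by field.
  have -> : gamma ^+ 2 * dot u u + 6400^-1 * dot m m =
    gamma / 80 * (80 * gamma * dot u u + (80 * gamma)^-1 * dot m m) by field.
  by rewrite ler_pM2l// divr_gt0.
have Z : dot (lapl V u) u <= 6400^-1 * dot m m by lra.
have N := dot_split V0 f; rewrite -/m in N.
have m0 := dot_ge0 m; have nm : dot m m <= n * dot m m by rewrite ler_peMl.
have q0 := dot_ge0 (fluct f).
have X1 := dot_amgm (fwd (pull u)) (fluct f) (ltr0n R 4 : 0 < 4%:R).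
have X2 := dot_amgmN (fwd (pull u)) (fluct f) (ltr0n R 4 : 0 < 4%:R).
rewrite (dot_fwd_pull Vsym V0) in X1 X2.
by rewrite ler_norml /cross -/u; apply/andP; split; lra.
Qed.

(** The right side is the time derivative of the correlation. One term moves the corrector and
    yields only errors; the other moves the fluctuation and yields the gain. *)
Lemma cross_gen f : gamma <= 1 ->
  dot (lapl V (corrector f)) (vavg f) - 20^-1 * dissipation f
    - gamma / 2 * dot (fluct f) (fluct f)
    <= cross (L f) f + cross f (L f).
Proof.
move=> g1; set Q := dot (lapl V _) (vavg f).
(* [2 Q] is the gain. Each error term is at most [Q / 4] (four of them) plus
   a multiple of [gamma * q] or of the dissipation. *)
set u := corrector f; set m := vavg f; set b := fluct f; set q := dot b b.
pose W := dot (lapl V u) (lapl V u); pose Z := dot (lapl V u) u.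
have W0 : 0 <= W by exact: dot_ge0.
have Z0 : 0 <= Z by exact: lapl_ge0.
have q0 : 0 <= q by exact: dot_ge0.
have uE := corrector_eq f; rewrite -/u -/m in uE.
(* The corrector equation paired with [lapl V u]: it bounds both [W] and [Z] by [Q]. *)
have QE : gamma / 40 * Q = gamma ^+ 2 * Z + W.
  by rewrite /Q -/u -/m -dotZr -uE dotDr dotZr.
have Q0 : 0 <= Q.
  rewrite -(pmulr_rge0 _ (_ : 0 < gamma / 40)) ?divr_gt0// QE.
  by rewrite addr_ge0 ?mulr_ge0 ?exprn_ge0// ltW.
have WQ : W <= gamma / 40 * Q by rewrite QE lerDr mulr_ge0 ?exprn_ge0// ltW.
have ZQ : gamma * Z <= 40^-1 * Q.
  rewrite -(ler_pM2l gamma0) mulrA -expr2 mulrA QE; lra.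
have k1 : 0 < 5 / gamma by rewrite divr_gt0.
have ngi : n^-1 <= 1 by rewrite invf_le1// (lt_le_trans ltr01).
have ngi0 : 0 < n^-1 by rewrite invr_gt0 (lt_le_trans ltr01).
have KW : 5 / gamma * (4 * W) <= 2^-1 * Q.
  have -> : 2^-1 * Q = 5 / gamma * (4 * (gamma / 40 * Q)) by field.
  by rewrite ler_pM2l// ler_pM2l.
have e1 : - dot (bwd (fwd (pull u))) b <= 4^-1 * Q + gamma / 10 * q.
  have := dot_amgmN (bwd (fwd (pull u))) b k1; rewrite invf_div => H.
  have H' : 5 / gamma * dot (bwd (fwd (pull u))) (bwd (fwd (pull u)) : S -> R)
      <= 5 / gamma * (4 * W) by rewrite ler_pM2l//; exact: dot_bwd_fwd_pull.
  rewrite -/q in H; lra.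
have e2 : gamma * dot (fwd (pull u)) b <= 4^-1 * Q + gamma / 20 * q.
  have := dot_amgm (fwd (pull u)) b (ltr0n R 10 : 0 < 10%:R).
  rewrite (dot_fwd_pull Vsym V0) -/Z -/q -(ler_pM2l gamma0); lra.
have pW : dot (pull (lapl V u) : S -> R) (pull (lapl V u)) = n * W by rewrite dot_pull_pull.
(* The [n^-1] from averaging cancels the [n] gained by pulling back a function on [G]. *)
have e3 (g : S -> R) : dot g g <= 4 * (n * W) -> n^-1 * dot g b <= 4^-1 * Q + gamma / 10 * q.
  move=> gW; have := dot_amgm g b k1; rewrite invf_div -/q => H.
  have H1 : 5 / gamma * dot g g <= 5 / gamma * (4 * (n * W)) by rewrite ler_pM2l.
  have H2 : n^-1 * (5 / gamma * (4 * (n * W))) = 5 / gamma * (4 * W) by field; rewrite n0 g0.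
  have H3 : n^-1 * (2 * dot g b) <= n^-1 * (5 / gamma * (4 * (n * W)) + gamma / 5 * q).
    by rewrite ler_pM2l//; lra.
  have H4 : n^-1 * (gamma / 5 * q) <= gamma / 5 * q.
    by rewrite ler_piMl// mulr_ge0// divr_ge0// ltW.
  rewrite mulrDr H2 in H3; lra.
have e3a : n^-1 * dot (fwd (pull (lapl V u))) b <= 4^-1 * Q + gamma / 10 * q.
  by apply: e3; rewrite -pW dot_fwd_le.
have e3b : n^-1 * dot (- bwd (pull (lapl V u))) b <= 4^-1 * Q + gamma / 10 * q.
  by apply: e3; rewrite dotNl dotNr opprK -pW dot_bwd_le.
(* The part of the corrector of [L f] that comes from transporting [b]. Its own equation bounds its
   Dirichlet form by a multiple of [gamma ^+ 2 * q]. *)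
pose u2 := resolvent ((gamma / 40) *: vavg (fwd b)).
have e4 : - dot (fwd (pull u2)) b <= gamma / 20 * q.
  pose Z2 := dot (lapl V u2) u2.
  have Z20 : 0 <= Z2 by exact: lapl_ge0.
  have k2 : 0 < 20 / gamma by rewrite divr_gt0.
  have H1 : gamma ^+ 2 * dot u2 u2 + Z2 = gamma / 40 * (n^-1 * dot (bwd (pull u2)) b).
    have := resolventK ((gamma / 40) *: vavg (fwd b)); rewrite -/u2 => /(congr1 (dot u2)).
    rewrite dotDr !dotZr (dotC u2 (lapl V u2)) -/Z2 => ->; congr (_ * _).
    apply: (mulfI n0); rewrite -dot_pull mulVKf// dotC dot_fwd; exact: dotC.
  have H2 := dot_amgm (bwd (pull u2)) b k2.
  rewrite invf_div (dot_bwd_pull Vsym V0) -/Z2 -/q in H2.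
  have H3 : n^-1 * (2 * dot (bwd (pull u2)) b) <= 20 / gamma * (2 * Z2) + gamma / 20 * q.
    apply: (@le_trans _ _ (n^-1 * (20 / gamma * (2 * Z2) + gamma / 20 * q))).
      by rewrite ler_pM2l.
    have gle := ltW gamma0.
    by rewrite ler_piMl// addr_ge0// !(mulr_ge0, invr_ge0).
  have H4 : gamma / 80 * (n^-1 * (2 * dot (bwd (pull u2)) b)) <=
      gamma / 80 * (20 / gamma * (2 * Z2) + gamma / 20 * q).
    by rewrite ler_pM2l// divr_gt0.
  have E1 : gamma / 80 * (20 / gamma * (2 * Z2) + gamma / 20 * q)
     = 2^-1 * Z2 + gamma ^+ 2 / 1600 * q by field.
  have H5 : 0 <= gamma ^+ 2 * dot u2 u2 by rewrite mulr_ge0 ?dot_ge0// exprn_ge0// ltW.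
  have Z2q : Z2 <= gamma ^+ 2 / 800 * q by lra.
  have H6 := dot_amgmN (fwd (pull u2)) b k2.
  rewrite invf_div (dot_fwd_pull Vsym V0) -/Z2 -/q in H6.
  have H7 : 20 / gamma * (2 * Z2) <= 20 / gamma * (2 * (gamma ^+ 2 / 800 * q)).
    by rewrite ler_pM2l// ler_pM2l.
  have E2 : 20 / gamma * (2 * (gamma ^+ 2 / 800 * q)) = gamma / 20 * q by field.
  lra.
have Y := lapl_diss Vsym V0 f; rewrite -/m -/b -/q in Y.
have Y0 : 0 <= dot (lapl V m) m by exact: lapl_ge0.
have e5 : n^-1 * dot (lapl V u) (lapl V m) <= 20^-1 * dissipation f + gamma / 10 * q.
  (* Substituting the corrector equation for [lapl V u] leaves [- gamma ^+ 2 * Q], which has a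
     favourable sign. *)
  have E1 : dot (lapl V u) (lapl V m) = gamma / 40 * dot (lapl V m) m - gamma ^+ 2 * Q.
    have -> : lapl V u = (gamma / 40) *: m - gamma ^+ 2 *: u by rewrite -uE addrC addKr.
    by rewrite dotDl dotNl !dotZl (dotC m) /Q -/u -/m (lapl_sym Vsym V0 u).
  have H1 : dot (lapl V u) (lapl V m) <= gamma / 40 * dot (lapl V m) m.
    by rewrite E1 gerBl mulr_ge0// exprn_ge0// ltW.
  have H2 : n^-1 * dot (lapl V u) (lapl V m) <= n^-1 * (gamma / 40 * dot (lapl V m) m).
    by rewrite ler_pM2l.
  have H3 : n^-1 * (gamma / 40 * dot (lapl V m) m) <= gamma / 40 * dot (lapl V m) m.
    by rewrite ler_piMl// mulr_ge0// divr_ge0// ltW.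
  have H4 : gamma / 40 * dot (lapl V m) m <= gamma / 40 * (2 * dissipation f + 4 * q).
    by rewrite ler_pM2l// divr_gt0.
  have H5 : gamma * dissipation f <= dissipation f by rewrite ler_piMl// dissipation_ge0.
  lra.
have mdot : vavg (L f) = - (n^-1 *: lapl V m) + vavg (fwd b).
  have vD g h : vavg (g + h : S -> R) = vavg g + vavg h.
    by have := vavg_linear 1 g h; rewrite !scale1r.
  have vb : vavg (- (gamma *: b)) = 0.
    have -> : - (gamma *: b) = (- gamma) *: b + 0 by rewrite addr0 scaleNr.
    rewrite vavg_linear /b (vavg_fluct V0) scaler0 add0r; apply/funext => x.
    by rewrite vavgE big1 ?mulr0.
  by rewrite lifted_genE (fwd_split f) 2!vD vb addr0 (vavg_fwd_pull Vsym).
(* [lapl V] commutes with [shifted], hence with the resolvent. *)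
have uL : corrector (L f) = (- n^-1) *: lapl V u + u2.
  apply: shifted_cancel; rewrite shifted_linear !resolventK mdot scalerDr.
  congr (_ + _).
  have -> : shifted (lapl V u) = lapl V (shifted u).
    by rewrite /shifted lapl_linear.
  rewrite /shifted uE; have := lapl_linear V (gamma / 40) m 0; rewrite addr0 => ->.
  rewrite (linear_zero (@lapl_linear R G V)).
  by rewrite addr0 scaleNr scalerN !scalerA mulrC.
have A1 : cross (L f) f = - (n^-1 * dot (fwd (pull (lapl V u))) b) + dot (fwd (pull u2)) b.
  by rewrite /cross uL pull_linear fwd_linear dotDl dotZl -/b mulNr.
have A2 : cross f (L f) = 2 * Q + dot (bwd (fwd (pull u))) b
    - gamma * dot (fwd (pull u)) b
    - n^-1 * dot (lapl V u) (lapl V m) - n^-1 * dot (- bwd (pull (lapl V u))) b.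
  rewrite /cross -/u.
  rewrite fluctE dotDr dotNr [dot (fwd (pull u)) (pull _)]dotC dot_pull.
  rewrite (vavg_fwd_pull Vsym) mdot lifted_genE (fwd_split f) -/m -/b.
  rewrite !dotDr !dotDl !dotNr !dotNl !dotZr !dotZl.
  rewrite (dot_fwd_pull Vsym V0) -/Q (dotC _ (fwd b)) (dot_fwd b) (dotC b).
  have -> : dot (vavg (fwd b)) (lapl V u) = n^-1 * dot (bwd (pull (lapl V u))) b.
    by apply: (mulfI n0); rewrite dotC -dot_pull mulVKf// dotC dot_fwd dotC.
  rewrite (dotC (lapl V m)); field.
  exact: n0.
(* The coefficients of [gamma * q] in [e1], [e2], [e3a], [e3b], [e4] and [e5] add up to exactly
   1/2. *)
rewrite A1 A2 -/q; lra.
Qed.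

Lemma lyapunov_small lam r : 0 < lam ->
  (forall u, L20 R u -> lam * dot u u <= dot (lapl V u) u) ->
  gamma <= 1 -> 0 <= r -> 120 * n * r * gamma <= lam -> 120 * n * r <= gamma ->
  lyapunov L r modified.
Proof.
move=> lam0 poincare g1 r0 r1 r2.
have mB f : 4^-1 * dot f f <= modified f f <= dot f f.
  have := cross_small f; rewrite ler_norml => /andP[c1 c2].
  have := dot_ge0 f => d0; rewrite /modified; apply/andP; split; lra.
split => //.
- by move=> a f g h; rewrite /modified cross_linl cross_linr dotDl dotZl; ring.
- by move=> f g; rewrite /modified dotC [cross f g + _]addrC.
move=> f f0.
have cg := cross_gen f g1; have D := dot_lifted_gen gamma V0 f; have N := dot_split V0 f.
have p0 := dissipation_ge0 f; have q0 := dot_ge0 (fluct f); have m0 := dot_ge0 (vavg f).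
move: cg D N p0 q0 m0; rewrite /=.
set u := corrector f; set m := vavg f; set q := dot (fluct f) (fluct f).
set Q := dot (lapl V u) m => cg D N p0 q0 m0.
pose W := dot (lapl V u) (lapl V u); pose Z := dot (lapl V u) u.
have W0 : 0 <= W by exact: dot_ge0.
have Z0 : 0 <= Z by exact: lapl_ge0.
have uE := corrector_eq f; rewrite -/u -/m in uE.
have QE : gamma / 40 * Q = gamma ^+ 2 * Z + W by rewrite /Q -dotZr -uE dotDr dotZr.
(* The squared norm of the corrector equation recovers the average from the energies of [u]. *)
have mE : (gamma / 40) ^+ 2 * dot m m = gamma ^+ 4 * dot u u + 2 * gamma ^+ 2 * Z + W.
  have -> : (gamma / 40) ^+ 2 * dot m m = dot ((gamma / 40) *: m) ((gamma / 40) *: m).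
    by rewrite dotZl dotZr; ring.
  by rewrite -uE !dotDl !dotDr !dotZl !dotZr (dotC u (lapl V u)) -/Z -/W; ring.
have u20 : L20 R u.
  have : mean (gamma ^+ 2 *: u + lapl V u) = 0.
    rewrite uE -[_ *: m]addr0 mean_linear (vavg_L20 V0 f0) mulr0 add0r.
    by rewrite /mean big1 ?mulr0.
  rewrite mean_linear (lapl_L20 Vsym u) addr0 => /eqP.
  by rewrite mulf_eq0 expf_eq0 /= (negbTE g0) => /eqP.
have P := poincare u u20; rewrite -/Z in P.
pose mu := 120 * n * r.
have mu0 : 0 <= mu by rewrite /mu !mulr_ge0// (le_trans ler01).
(* This says [n * r * dot m m <= Q]. Poincare for the mean-zero [u] bounds the left side by three
   copies of the energies in [QE], and 120 is this 3 times the 40 of the corrector. *)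
have muQ : mu * dot m m <= 120 * Q.
  have K : 0 < (gamma / 40) ^+ 2 by rewrite exprn_gt0// divr_gt0.
  rewrite -(ler_pM2l K) mulrCA mE.
  have E : (gamma / 40) ^+ 2 * (120 * Q) = 3 * gamma * (gamma / 40 * Q) by field.
  rewrite E QE.
  have H1 : mu * gamma * (gamma ^+ 3 * dot u u) <= lam * (gamma ^+ 3 * dot u u).
    by rewrite ler_wpM2r// mulr_ge0 ?dot_ge0// exprn_ge0// ltW.
  have H2 : gamma ^+ 3 * (lam * dot u u) <= gamma ^+ 3 * Z.
    by rewrite ler_pM2l// exprn_gt0.
  have H3 : mu * (2 * gamma ^+ 2 * Z + W) <= gamma * (2 * gamma ^+ 2 * Z + W).
    by rewrite ler_wpM2r// addr_ge0// !mulr_ge0// ltW.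
  have H4 : 0 <= gamma * W by rewrite mulr_ge0// ltW.
  have -> : mu * (gamma ^+ 4 * dot u u + 2 * gamma ^+ 2 * Z + W)
    = mu * gamma * (gamma ^+ 3 * dot u u) + mu * (2 * gamma ^+ 2 * Z + W) by ring.
  have -> : 3 * gamma * (gamma ^+ 2 * Z + W)
    = gamma ^+ 3 * Z + gamma * (2 * gamma ^+ 2 * Z + W) + 2 * (gamma * W) by ring.
  lra.
have /andP[_ mN] := mB f.
have H5 : r * modified f f <= r * dot f f by rewrite ler_wpM2l.
have H6 : r * q <= n * r * q by rewrite ler_wpM2r// ler_peMl.
have H7 : 120 * n * r * q <= gamma * q by rewrite ler_wpM2r.
have H8 : 2 * modified (L f) f = dot (L f) f - (cross (L f) f + cross f (L f)).
  by rewrite /modified; field.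
have H9 : 0 <= gamma * q by rewrite mulr_ge0// ltW.
rewrite H8 D -/q; rewrite N -/q -/m in H5; rewrite /mu in muQ; lra.
Qed.

End Lyapunov.

(** * The semigroup *)

Section ExponentialSeries.
Variable R : realType.
Implicit Types (a : nat -> R) (t : R).

(** The factorials are kept out of [a], so that differentiation shifts [a]. *)
Definition expseries a t : R := limn (pseries (fun n => a n / n`!%:R) t).

Definition geom_bounded a := exists A K : R, forall n, `|a n| <= A * K ^+ n.

Lemma geom_bounded_shift a : geom_bounded a -> geom_bounded (fun n => a n.+1).
Proof.
by move=> [A [K H]]; exists (A * K), K => n; rewrite -mulrA -exprS.
Qed.

Lemma cvg_expseries a t : geom_bounded a -> cvgn (pseries (fun n => a n / n`!%:R) t).
Proof.
move=> [A [K H]]; apply: normed_cvg; rewrite /normed_series_of /=.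
have C := is_cvg_series_exp_coeff (`|K| * `|t|).
apply: (@series_le_cvg R _ (`|A| *: exp_coeff (`|K| * `|t|))) => [n|n|n|].
- exact: normr_ge0.
- by rewrite /= mulr_ge0// /exp_coeff /= divr_ge0// exprn_ge0// mulr_ge0.
- rewrite -[leRHS]/(`|A| * ((`|K| * `|t|) ^+ n / n`!%:R)).
  rewrite !normrM normfV [`|n`!%:R|]ger0_norm// normrX exprMn.
  have -> : `|a n| / n`!%:R * `|t| ^+ n = `|a n| * (`|t| ^+ n / n`!%:R) by ring.
  have -> : `|A| * (`|K| ^+ n * `|t| ^+ n / n`!%:R) =
    (`|A| * `|K| ^+ n) * (`|t| ^+ n / n`!%:R) by ring.
  rewrite ler_wpM2r ?divr_ge0 ?exprn_ge0//.
  by apply: (le_trans (H n)); rewrite -normrX -normrM ler_norm.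
- exact: is_cvg_seriesZ.
Qed.

Lemma pseries_diffs_fact a :
  pseries_diffs (fun n => a n / n`!%:R) = (fun n => a n.+1 / n`!%:R).
Proof.
apply/funext => n; rewrite /pseries_diffs factS natrM.
have n0 : (n`!%:R : R) != 0 by rewrite pnatr_eq0 -lt0n fact_gt0.
by field; rewrite n0 /= -?natrD ?nat1r ?natr1 pnatr_eq0.
Qed.

Lemma is_derive_expseries a t : geom_bounded a ->
  is_derive t (1 : R) (expseries a) (expseries (fun n => a n.+1) t).
Proof.
move=> ag; have ag1 := geom_bounded_shift ag; have ag2 := geom_bounded_shift ag1.
have := @pseries_snd_diffs R (fun n => a n / n`!%:R) (`|t| + 1) t.
rewrite !pseries_diffs_fact; apply; try exact: cvg_expseries.
by rewrite [ltRHS]ger0_norm ?addr_ge0// ltrDl.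
Qed.

Lemma expseries0 a : expseries a 0 = a 0%N.
Proof.
(* The empty partial sum is 0, so the partial sums are constant only from index 1 on. *)
rewrite /expseries; apply: cvg_lim => //; rewrite -cvg_shiftS.
apply: cvg_near_cst; near=> n; rewrite /pseries /series /=.
rewrite big_nat_recl// big1 ?addr0; first by rewrite fact0 divr1 expr0 mulr1.
by move=> i _; rewrite expr0n /= mulr0.
Unshelve. all: by end_near. Qed.

Lemma expseries_linear (I : finType) (a : I -> nat -> R) (c : I -> R) t :
  (forall i, geom_bounded (a i)) ->
  expseries (fun n => \sum_i a i n * c i) t = \sum_i expseries (a i) t * c i.
Proof.
move=> ag; rewrite /expseries; apply: cvg_lim => //.
have -> : pseries (fun n => (\sum_i a i n * c i) / n`!%:R) t =
  (fun N => \sum_i pseries (fun n => a i n / n`!%:R) t N * c i).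
  apply/funext => N; rewrite /pseries /series /=.
  under [RHS]eq_bigr do rewrite mulr_suml.
  rewrite exchange_big; apply: eq_bigr => n _ /=.
  by rewrite !mulr_suml; apply: eq_bigr => i _; ring.
apply: cvg_big => [|i _]; first exact: add_continuous.
by apply: cvgMr_tmp; exact: cvg_expseries.
Qed.

Lemma is_derive_bigsum (I : Type) (r : seq I) (h : I -> R -> R) (dh : I -> R) (t : R) :
  (forall i, is_derive t (1 : R) (h i) (dh i)) ->
  is_derive t (1 : R) (fun u => \sum_(i <- r) h i u) (\sum_(i <- r) dh i).
Proof.
move=> H; elim: r => [|i r IH].
  rewrite big_nil; under eq_fun do rewrite big_nil; exact: is_derive_cst.
rewrite big_cons; under eq_fun do rewrite big_cons.
exact: is_deriveD.
Qed.

End ExponentialSeries.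

(** * The exponential of a linear map *)

Section Semigroup.
Variables (R : realType) (S : finType) (T : (S -> R) -> (S -> R)).
Hypothesis Tl : linear T.
Implicit Types f g h : S -> R.
Local Notation P := (semigroup T).

Lemma semigroupE t f s : P t f s = expseries (fun n => iter n T f s) t.
Proof.
rewrite /semigroup /expseries /pseries; congr (limn (series _)).
by apply/funext => n; rewrite /exp_coeff /=; ring.
Qed.

Lemma iter_geom_bounded f s : geom_bounded (fun n => iter n T f s).
Proof.
have [C C0 HC] := linear_bounded Tl.
have H n : dot (iter n T f) (iter n T f) <= C ^+ n * dot f f.
  elim: n => [|n IH]; first by rewrite expr0 mul1r.
  apply: (le_trans (HC _)); rewrite exprS -mulrA ler_pM2l//; exact: IH.
exists (1 + dot f f), (1 + C) => n.
have d0 := dot_ge0 f.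
have c1 : C ^+ n <= (1 + C) ^+ n by rewrite lerXn2r ?nnegrE ?addr_ge0 ?lerDr// ltW.
have c0 : 0 <= C ^+ n by rewrite exprn_ge0// ltW.
have c2 : 1 <= (1 + C) ^+ n by rewrite exprn_ege1// lerDl ltW.
have B0 : 0 <= (1 + dot f f) * (1 + C) ^+ n by rewrite mulr_ge0// ?addr_ge0// (le_trans ler01).
rewrite -(@ler_pXn2r _ 2)// ?nnegrE// real_normK ?num_real//.
apply: (@le_trans _ _ (C ^+ n * dot f f)).
  apply: le_trans (H n); rewrite /dot (bigD1 s)//= -expr2 lerDl.
  by apply: sumr_ge0 => i _; rewrite -expr2 sqr_ge0.
rewrite exprMn [leRHS]mulrC; apply: ler_pM => //.
  by apply: (le_trans c1); rewrite ler_eXnr// (le_trans ler01).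
by rewrite expr2; nra.
Qed.

Lemma linear_functional (l : (S -> R) -> R) :
  (forall a f g, l (a *: f + g) = a * l f + l g) ->
  forall f, l f = \sum_s f s * l (@delta R S s).
Proof.
move=> ll f; rewrite {1}(delta_expand f).
have l0 : l 0 = 0 by have := ll (-1) 0 0; rewrite scaler0 addr0 => ->; rewrite mulN1r addNr.
by elim/big_rec2: _ => // i y1 y2 _ <-; rewrite ll.
Qed.

(** A linear functional is a finite combination of coordinates, so it passes under the series. This
    yields commutation with [T] and preservation of mean zero. *)
Lemma semigroup_functional (l : (S -> R) -> R) t f :
  (forall a f g, l (a *: f + g) = a * l f + l g) ->
  l (P t f) = expseries (fun n => l (iter n T f)) t.
Proof.
move=> ll; rewrite (linear_functional ll).
under eq_bigr do rewrite semigroupE.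
rewrite -expseries_linear; last by move=> s; exact: iter_geom_bounded.
by congr expseries; apply/funext => n; rewrite [RHS]linear_functional.
Qed.

Lemma semigroup_comm t f : T (P t f) = P t (T f).
Proof.
apply/funext => s; rewrite semigroupE.
rewrite (@semigroup_functional (fun g => T g s)).
  by congr expseries; apply/funext => n; rewrite -iterS iterSr.
by move=> a g h; rewrite Tl.
Qed.

Lemma semigroup0 f : P 0 f = f.
Proof. by apply/funext => s; rewrite semigroupE expseries0. Qed.

Lemma is_derive_semigroup f s t :
  is_derive t (1 : R) (fun u => P u f s) (T (P t f) s).
Proof.
rewrite semigroup_comm semigroupE.
under eq_fun do rewrite semigroupE.
have -> : (fun n => iter n T (T f) s) = (fun n => iter n.+1 T f s).
  by apply/funext => n; rewrite iterSr.
exact/is_derive_expseries/iter_geom_bounded.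
Qed.

Lemma semigroup_L20 t f : (forall g, L20 R g -> L20 R (T g)) -> L20 R f -> L20 R (P t f).
Proof.
move=> T20 f0; rewrite /L20 /= (@semigroup_functional (@mean S R)); last first.
  by move=> a g h; exact: mean_linear.
(* The zero sequence is written as an empty sum so that [expseries_linear] evaluates its series. *)
have -> : (fun n => mean (iter n T f)) = (fun n => \sum_(i : 'I_0) 0 * 0).
  apply/funext => n; rewrite big_ord0; elim: n => [|n IH]; first exact: f0.
  exact: T20.
rewrite (@expseries_linear _ _ (fun _ _ => 0) (fun _ => 0)) ?big_ord0//.
by move=> -[].
Qed.

(** * Decay of quadratic forms along the semigroup *)

Section Bilinear.
Variable B : (S -> R) -> (S -> R) -> R.
Hypothesis Bl : forall a f g h, B (a *: f + g) h = a * B f h + B g h.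
Hypothesis Bsym : forall f g, B f g = B g f.

Lemma bilinear_expand f g :
  B f g = \sum_s \sum_s' f s * (g s' * B (@delta R S s) (@delta R S s')).
Proof.
rewrite (@linear_functional (B^~ g)); last by move=> a h k; exact: Bl.
apply: eq_bigr => s _; rewrite -mulr_sumr; congr (_ * _).
rewrite Bsym (@linear_functional (B^~ (@delta R S s))); last by move=> a h k; exact: Bl.
by apply: eq_bigr => s' _; rewrite Bsym.
Qed.

Lemma is_derive_energy f t :
  is_derive t (1 : R) (fun u => B (P u f) (P u f)) (2 * B (T (P t f)) (P t f)).
Proof.
have -> : 2 * B (T (P t f)) (P t f) = \sum_s \sum_s'
   ((P t f s * T (P t f) s' + P t f s' * T (P t f) s) * B (@delta R S s) (@delta R S s')).
  have -> : 2 * B (T (P t f)) (P t f) = B (P t f) (T (P t f)) + B (T (P t f)) (P t f).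
    by rewrite (Bsym (P t f)); ring.
  rewrite !bilinear_expand -big_split; apply: eq_bigr => s _.
  by rewrite -big_split; apply: eq_bigr => s' _ /=; ring.
under eq_fun do rewrite bilinear_expand.
apply: is_derive_bigsum => s; apply: is_derive_bigsum => s'.
have Ds := is_derive_semigroup f s t; have Ds' := is_derive_semigroup f s' t.
have -> : (fun u => P u f s * (P u f s' * B (@delta R S s) (@delta R S s')))
  = (B (@delta R S s) (@delta R S s')) *: ((fun u => P u f s) * (fun u => P u f s')).
  apply/funext => u.
  rewrite -[RHS]/(B (@delta R S s) (@delta R S s') * (P u f s * P u f s')); ring.
apply: (is_derive_eq (is_deriveZ (B (@delta R S s) (@delta R S s')) (is_deriveM Ds Ds'))).
rewrite -[LHS]/(B (@delta R S s) (@delta R S s') *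
  (P t f s * T (P t f) s' + P t f s' * T (P t f) s)).
by ring.
Qed.

(** Gronwall: since mean zero is preserved, [expR (r * u)] times the form has nonpositive derivative
    at every time. *)
Lemma energy_decay r : (forall f, L20 R f -> L20 R (T f)) ->
  (forall f, L20 R f -> 2 * B (T f) f <= - r * B f f) ->
  forall f t, L20 R f -> 0 <= t -> B (P t f) (P t f) <= expR (- (r * t)) * B f f.
Proof.
move=> T20 Br f t f0 t0.
pose F u := B (P u f) (P u f).
pose H u := expR (r * u) * F u.
have dF u : is_derive u (1 : R) F (2 * B (T (P u f)) (P u f)) by exact: is_derive_energy.
have dH u : is_derive u (1 : R) H
    (expR (r * u) * (2 * B (T (P u f)) (P u f)) + F u * (r * expR (r * u))).
  have dE : is_derive u (1 : R) (fun u => expR (r * u)) (r * expR (r * u)).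
    have d1 : is_derive u (1 : R) (r \*: (@id R)) (r *: (1 : R)) by exact: is_deriveZ.
    apply: (is_derive_eq (is_derive1_comp (is_derive_expR (r * u)) d1)).
    by rewrite -[LHS]/(expR (r * u) * (r * 1)); ring.
  have -> : H = (fun u => expR (r * u)) * F by [].
  exact: (is_derive_eq (is_deriveM dE (dF u))).
have H1 x : derivable H x 1 by case: (dH x).
have H2 x : H^`()%classic x <= 0.
  rewrite derive1E (@derive_val _ _ _ _ _ _ _ (dH x)).
  have := Br _ (semigroup_L20 x T20 f0); rewrite -/(F x) => K.
  have e0 := expR_gt0 (r * x).
  have : expR (r * x) * (2 * B (T (P x f)) (P x f) + r * F x) <= 0.
    by rewrite pmulr_rle0//; lra.
  by lra.
have : H t <= H 0.
  apply: (@ler0_derive1_nincr _ H 0 t) => //.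
  by apply: derivable_within_continuous => x _.
rewrite /H mulr0 expR0 mul1r /F semigroup0 => K.
by rewrite expRN mulrC ler_pdivlMr ?expR_gt0// mulrC.
Qed.

End Bilinear.

Lemma averaged_semigroup t h s : 0 < t ->
  averaged P t (T h) s = t^-1 * (P t h s - h s).
Proof.
move=> t0; rewrite /averaged; congr (_ * _).
have dP u : is_derive u (1 : R) (fun u => P u h s) (P u (T h) s).
  by rewrite -semigroup_comm; exact: is_derive_semigroup.
have cts g : continuous (fun u => P u g s).
  move=> u; apply: differentiable_continuous; apply/derivable1_diffP.
  by case: (is_derive_semigroup g s u).
rewrite /Rintegral (@continuous_FTC2 _ _ (fun u => P u h s)) //=.
- by rewrite semigroup0.
- exact/continuous_subspaceT/cts.
- split.
  + by move=> u _; case: (dP u).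
  + by apply: cvg_at_right_filter; exact: cts.
  + by apply: cvg_at_left_filter; exact: cts.
- by move=> u _; rewrite derive1E (@derive_val _ _ _ _ _ _ _ (dP u)).
Qed.

End Semigroup.

(** * From coercivity and Lyapunov forms to relaxation times and gap *)

Section Relaxation.
Variables (R : realType) (S : finType) (T : (S -> R) -> (S -> R)).
Hypothesis Tl : linear T.
Hypothesis T20 : forall f, L20 R f -> L20 R (T f).
Implicit Types f g h : S -> R.
Local Notation P := (semigroup T).

Lemma L2normE f : L2norm f = Num.sqrt (#|S|%:R^-1 * dot f f).
Proof.
by rewrite /L2norm /mean; congr (Num.sqrt (_ * _)); apply: eq_bigr => s _; rewrite expr2.
Qed.

Lemma opnorm_le (U : (S -> R) -> (S -> R)) (c : R) : 0 <= c ->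
  (forall f, L20 R f -> dot (U f) (U f) <= c ^+ 2 * dot f f) ->
  (opnorm U <= c%:E)%E.
Proof.
move=> c0 H; apply: ge_ereal_sup => _ [f [f0 f1] <-]; rewrite lee_fin.
have N0 : 0 <= #|S|%:R^-1 :> R by rewrite invr_ge0.
apply: (@le_trans _ _ (c * L2norm f)); last by rewrite ler_piMr.
have -> : c = Num.sqrt (c ^+ 2) by rewrite sqrtr_sqr ger0_norm.
rewrite !L2normE -sqrtrM ?sqr_ge0//.
apply: ler_wsqrtr; rewrite mulrCA; apply: ler_wpM2l => //; exact: H.
Qed.

Lemma contraction : (forall f, L20 R f -> dot (T f) f <= 0) ->
  forall f t, L20 R f -> 0 <= t -> dot (P t f) (P t f) <= dot f f.
Proof.
move=> Td f t f0 t0.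
have := @energy_decay R S T Tl (@dot R S) _ _ 0 T20 _ f t f0 t0.
rewrite mul0r oppr0 expR0 mul1r; apply.
- by move=> a g h k; rewrite dotDl dotZl.
- by move=> g h; rewrite dotC.
- by move=> g g0; rewrite mul0r; have := Td g g0; lra.
Qed.

(* With [T h = f], the time average of [P_u f] over [0, t] is [(P_t h - h) / t],
   so only the inverse of the generator needs to be bounded. *)
Lemma tbar_rel_le (M : R) : 0 < M ->
  (forall f, L20 R f -> dot (T f) f <= 0) ->
  (forall f, L20 R f -> dot f f <= 64 * M ^+ 2 * dot (T f) (T f)) ->
  (tbar_rel P <= (16 * expR 1 * M)%:E)%E.
Proof.
move=> M0 Td Tc; have e0 : 0 < expR 1 :> R by exact: expR_gt0.
have t0 : 0 < 16 * expR 1 * M by rewrite !mulr_gt0.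
apply: ereal_inf_lbound; exists (16 * expR 1 * M) => //; split; first exact: ltW.
move=> t tM; have tp : 0 < t by exact: lt_le_trans tM.
apply: opnorm_le; first by rewrite invr_ge0 ltW.
move=> f f0.
have Tinj g : L20 R g -> T g = 0 -> g = 0.
  move=> g0 Tg; apply: dot_eq0; apply/eqP; rewrite eq_le dot_ge0 andbT.
  by have := Tc g g0; rewrite Tg dot0l mulr0.
have [h h0 hf] := L20_inj_surj Tl T20 Tinj f0.
have -> : averaged P t f = t^-1 *: (P t h - h).
  by apply/funext => s; rewrite -hf averaged_semigroup.
have K1 := contraction Td h0 (ltW tp).
have K2 : dot (P t h - h) (P t h - h) <= 4 * dot h h.
  have := dot_ge0 (P t h + h); rewrite !dotE (dotC h (P t h)) => K; lra.
have K3 : dot h h <= 64 * M ^+ 2 * dot f f by rewrite -hf; exact: Tc.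
rewrite dotZl dotZr mulrA -expr2 !exprVn.
(* A factor 2 from [P t h - h] and a factor 8 from the inverse make up the constant 16. *)
have K4 : expR 1 ^+ 2 * dot (P t h - h) (P t h - h) <= t ^+ 2 * dot f f.
  apply: (@le_trans _ _ ((16 * expR 1 * M) ^+ 2 * dot f f)).
    have -> : (16 * expR 1 * M) ^+ 2 * dot f f
      = expR 1 ^+ 2 * (4 * (64 * M ^+ 2 * dot f f)) by ring.
    by rewrite ler_pM2l ?exprn_gt0//; lra.
  by rewrite ler_wpM2r ?dot_ge0// lerXn2r// nnegrE ltW.
by rewrite ler_pdivrMl ?exprn_gt0// mulrCA ler_pdivlMl ?exprn_gt0.
Qed.

Lemma lyapunov_decay r B : lyapunov T r B -> forall f t, L20 R f -> 0 <= t ->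
  dot (P t f) (P t f) <= 4 * expR (- (r * t)) * dot f f.
Proof.
move=> [Bl Bs Bn Bd] f t f0 t0.
have := energy_decay Tl Bl Bs T20 Bd f0 t0.
have /andP[H1 _] := Bn (P t f); have /andP[_ H2] := Bn f.
have := expR_gt0 (- (r * t)) => e0 H3.
have : expR (- (r * t)) * B f f <= expR (- (r * t)) * dot f f by rewrite ler_pM2l.
lra.
Qed.

(** At this time the decay factor is [4 * (eps / N) ^+ 2], and [2 <= N] absorbs the 4. In the
    application [N] is the order of [G]. *)
Lemma t_rel_le r B (N eps : R) : lyapunov T r B -> 0 < r -> 2 <= N -> 0 < eps <= N ->
  (t_rel P eps <= (2 / r * ln (N / eps))%:E)%E.
Proof.
move=> TB r0 N2 /andP[e0 eN].
have N0 : 0 < N by apply: lt_le_trans N2.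
have l0 : 0 <= ln (N / eps) by rewrite ln_ge0// ler_pdivlMr// mul1r.
have t0 : 0 <= 2 / r * ln (N / eps) by rewrite mulr_ge0// divr_ge0// ltW.
apply: ereal_inf_lbound; exists (2 / r * ln (N / eps)) => //; split => //.
apply: opnorm_le; first exact: ltW.
move=> f f0; apply: (le_trans (lyapunov_decay TB f0 t0)).
rewrite ler_wpM2r ?dot_ge0//.
have -> : r * (2 / r * ln (N / eps)) = 2 * ln (N / eps).
  by field; rewrite gt_eqF.
rewrite -mulrN expRM_natl expRN lnK ?posrE ?divr_gt0// invf_div.
rewrite expr_div_n mulrCA ler_piMr ?sqr_ge0//.
rewrite ler_pdivrMr ?exprn_gt0// mul1r.
have -> : 4 = 2 ^+ 2 :> R by ring.
by rewrite lerXn2r// nnegrE ltW.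
Qed.

Lemma sum_L20 (K : numFieldType) (f : S -> K) : L20 K f <-> \sum_s f s = 0.
Proof.
rewrite /L20 /= /mean; split => [/eqP|->]; last by rewrite mulr0.
rewrite mulf_eq0 invr_eq0 pnatr_eq0 => /orP[/eqP S0|/eqP//].
by apply: big_pred0 => s; have := card0_eq S0 s.
Qed.

Lemma Re_sum (f : S -> R[i]) : complex.Re (\sum_s f s) = \sum_s complex.Re (f s).
Proof. by elim/big_rec2: _ => // s y1 y2 _ <-; case: (f s) y2 => a b []. Qed.

Lemma Im_sum (f : S -> R[i]) : complex.Im (\sum_s f s) = \sum_s complex.Im (f s).
Proof. by elim/big_rec2: _ => // s y1 y2 _ <-; case: (f s) y2 => a b []. Qed.

Lemma L20_complex (f : S -> R[i]) :
  L20 R[i] f <-> L20 R (fun s => complex.Re (f s)) /\ L20 R (fun s => complex.Im (f s)).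
Proof.
rewrite !sum_L20 -Re_sum -Im_sum; split; first by move=> ->.
by case: (\sum_s f s) => a b /= [-> ->].
Qed.

(** Let [u] and [w] be the real and imaginary parts of a solution of [T f = - z f]. Adding the decay
    inequalities for [u] and [w] cancels the terms in the imaginary part of [z], so [f = 0] when the
    real part is below [r / 2]. Injectivity then gives bijectivity by dimension. *)
Lemma spectral_gap_ge r B : lyapunov T r B ->
  ((r / 2)%:E <= spectral_gap T)%E.
Proof.
move=> [Bl Bs Bn Bd].
apply: le_ereal_inf_tmp => _ [z zs <-]; rewrite lee_fin leNgt; apply/negP => zr.
apply: zs.
pose N (f : S -> R) s := - T f s.
have NlE a u w s : N (a *: u + w) s = a * N u s + N w s.
  by rewrite /N Tl -[(_ + _) s]/(a * T u s + T w s); ring.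
pose U (f : S -> R[i]) s := z * f s - complexify N f s.
have Ul : linear U.
  move=> [a b] f g; apply/funext => s.
  rewrite -[RHS]/((a +i* b)%C * U f s + U g s) /U /complexify.
  pose fr s := complex.Re (f s); pose fi s := complex.Im (f s).
  pose gr s := complex.Re (g s); pose gi s := complex.Im (g s).
  have -> : (fun s' => complex.Re (((a +i* b)%C *: f + g) s')) = a *: fr + ((-b) *: fi + gr).
    apply/funext => t.
    rewrite -[LHS]/(complex.Re ((a +i* b)%C * f t + g t)) -[RHS]/(a * fr t + (- b * fi t + gr t)).
    by rewrite /fr /fi /gr; case: (f t) => p q; case: (g t) => p' q' /=; ring.
  have -> : (fun s' => complex.Im (((a +i* b)%C *: f + g) s')) = a *: fi + (b *: fr + gi).
    apply/funext => t.
    rewrite -[LHS]/(complex.Im ((a +i* b)%C * f t + g t)) -[RHS]/(a * fi t + (b * fr t + gi t)).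
    by rewrite /fr /fi /gi; case: (f t) => p q; case: (g t) => p' q' /=; ring.
  rewrite !NlE -/fr -/fi -/gr -/gi -[((a +i* b)%C *: f + g) s]/((a +i* b)%C * f s + g s).
  move: (N fr s) (N fi s) (N gr s) (N gi s) => x1 x2 x3 x4.
  case: (z) (f s) (g s) => x y [p q] [p' q'].
  by apply/eqP; rewrite eq_complex /=; apply/andP; split; apply/eqP; ring.
have U20 (f : S -> R[i]) : L20 R[i] f -> L20 R[i] (U f).
  move=> f0; have /L20_complex[fr0 fi0] := f0; apply/sum_L20; rewrite /U sumrB -mulr_sumr.
  have -> : \sum_s f s = 0 by apply/sum_L20.
  rewrite mulr0 sub0r; apply/eqP; rewrite oppr_eq0; apply/eqP.
  have TN0 (h : S -> R) : L20 R h -> \sum_s N h s = 0.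
    by move=> h0; rewrite sumrN; apply/eqP; rewrite oppr_eq0; apply/eqP/sum_L20/T20.
  have Rz := Re_sum (complexify N f); have Iz := Im_sum (complexify N f).
  rewrite TN0 // in Rz; rewrite TN0 // in Iz.
  by case: (\sum_s _) Rz Iz => x y /= -> ->.
have U0 (f : S -> R[i]) : L20 R[i] f -> U f = 0 -> f = 0.
  move=> /L20_complex[].
  set u := fun s => complex.Re (f s); set w := fun s => complex.Im (f s) => u0 w0 Uf.
  have TE s : T u s = complex.Im z * w s - complex.Re z * u s /\
      T w s = - complex.Im z * u s - complex.Re z * w s.
    have := congr1 (@^~ s) Uf; rewrite /U /complexify -/u -/w /N /u /w.
    move: (T u s) (T w s) => a b; case: (z) (f s) => x y [p q] /eqP.
    rewrite eq_complex /= => /andP[/eqP E1 /eqP E2].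
    by split; lra.
  have Tu : T u = complex.Im z *: w + (- complex.Re z) *: u.
    by apply/funext => s; have [-> _] := TE s; rewrite mulrC -mulNr mulrC.
  have Tw : T w = (- complex.Im z) *: u + (- complex.Re z) *: w.
    by apply/funext => s; have [_ ->] := TE s; rewrite -mulNr.
  have B0 h : B 0 h = 0.
    by have := Bl (-1) 0 0 h; rewrite scaler0 addr0 mulN1r addNr.
  have BZ a g h : B (a *: g) h = a * B g h.
    by have := Bl a g 0 h; rewrite B0 !addr0.
  have := Bd u u0; have := Bd w w0; rewrite Tu Tw !Bl !BZ (Bs w u) => D1 D2.
  have /andP[N1 _] := Bn u; have /andP[N2 _] := Bn w.
  have p1 := dot_ge0 u; have p2 := dot_ge0 w.
  have pos : 0 <= B u u + B w w by lra.
  have K : (r - 2 * complex.Re z) * (B u u + B w w) <= 0 by lra.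
  have rz : 0 < r - 2 * complex.Re z by lra.
  rewrite pmulr_rle0// in K.
  have du : u = 0 by apply: dot_eq0; lra.
  have dw : w = 0 by apply: dot_eq0; lra.
  apply/funext => s; have := congr1 (@^~ s) du; have := congr1 (@^~ s) dw.
  by rewrite /u /w; case: (f s) => p q /= -> ->.
split.
- exact: U20.
- move=> f g /set_mem f0 /set_mem g0 fg; apply/eqP; rewrite -subr_eq0; apply/eqP.
  apply: U0.
    rewrite addrC -scaleN1r /L20 /= mean_linear f0 g0 mulr0 addr0.
    by [].
  have := Ul (-1) g f; rewrite !scaleN1r => E; rewrite addrC E addrC.
  by apply/eqP; rewrite subr_eq0; apply/eqP.
- move=> g g0; have [f f0 fg] := L20_inj_surj Ul U20 U0 g0.
  by exists f.
Qed.

End Relaxation.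

(** * The lifted walk *)

Section LiftedWalkBounds.
Variables (R : realType) (G : finZmodType) (V : {set G}) (gamma : R).
Local Notation S := (state V).
Local Notation n := (#|V|%:R : R).
Local Notation L := (lifted_gen V gamma).
Hypothesis Vsym : symmetric_generators V.
Hypothesis gamma0 : 0 < gamma.

(** * The one-element group *)

Section Trivial.
Hypothesis G1 : (#|G| <= 1)%N.

Lemma trivial_eq (x y : G) : x = y.
Proof. exact: (card_le1_eqP G1). Qed.

Lemma trivial_L20 (f : S -> R) : L20 R f -> f = 0.
Proof.
move=> /sum_L20 f0; apply/funext => s.
have one (t : S) : t = s.
  by case: t s => x v [y w]; congr (_, _); [|apply: val_inj]; exact: trivial_eq.
move: f0; rewrite (bigD1 s)//= big1 ?addr0// => t.
by rewrite (one t) eqxx.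
Qed.

Lemma trivial_gen_L20 (f : S -> R) : L20 R f -> L20 R (L f).
Proof.
move=> /trivial_L20 ->; rewrite (linear_zero (@lifted_gen_linear R G V gamma)).
by rewrite /L20 /= /mean big1 ?mulr0.
Qed.

Lemma trivial_lyapunov r : lyapunov L r (fun f g => 2^-1 * dot f g).
Proof.
split.
- by move=> a f g h; rewrite dotDl dotZl; ring.
- by move=> f g; rewrite dotC.
- by move=> f; have := dot_ge0 f => H; apply/andP; split; lra.
by move=> f /trivial_L20 ->; rewrite dot0l dotC dot0l !mulr0.
Qed.

Lemma trivial_tbar :
  (tbar_rel (lifted_semigroup V gamma) <= (16 * expR 1 * ((1 + 2 * n) / gamma))%:E)%E.
Proof.
apply: (tbar_rel_le (@lifted_gen_linear R G V gamma) trivial_gen_L20).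
- by rewrite divr_gt0// ltr_pwDl// mulr_ge0.
- by move=> f /trivial_L20 ->; rewrite dotC dot0l.
- by move=> f /trivial_L20 ->; rewrite dot0l mulr_ge0 ?dot_ge0// mulr_ge0// sqr_ge0.
Qed.

Lemma trivial_gap :
  ((240^-1)%:E * n^-1%:E * mine (gap_laplacian R V * (Num.max 1 gamma^-1)%:E) gamma%:E
     <= spectral_gap L)%E.
Proof.
apply: le_trans (spectral_gap_ge (@lifted_gen_linear R G V gamma) trivial_gen_L20
  (trivial_lyapunov (2 * (240^-1 * n^-1 * gamma)))).
have -> : 2 * (240^-1 * n^-1 * gamma) / 2 = 240^-1 * n^-1 * gamma.
  by rewrite mulrAC mulfV ?mul1r// pnatr_eq0.
rewrite -EFinM [leRHS]EFinM; apply: lee_wpmul2l.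
  by rewrite lee_fin mulr_ge0 ?invr_ge0.
(* The gap of the Laplacian is [+oo] here; the comparison is with [gamma]. *)
by rewrite ge_min lexx orbT.
Qed.

Lemma trivial_t_rel (eps : R) : 0 < eps <= #|G|%:R ->
  (t_rel (lifted_semigroup V gamma) eps
   <= 240%:E * n%:E * maxe ((Num.min 1 gamma)%:E / gap_laplacian R V) (gamma^-1)%:E
      * (ln (#|G|%:R / eps))%:E)%E.
Proof.
move=> /andP[e0 eG].
apply: (@le_trans _ _ 0%:E).
  apply: ereal_inf_lbound; exists 0 => //; split => //.
  apply: opnorm_le; first exact: ltW.
  move=> f /trivial_L20 ->.
  by rewrite /lifted_semigroup semigroup0 dot0l mulr0.
apply: mule_ge0; last by rewrite lee_fin ln_ge0// ler_pdivlMr// mul1r.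
apply: mule_ge0; first by rewrite -EFinM lee_fin mulr_ge0.
by rewrite le_max lee_fin invr_ge0 (ltW gamma0) orbT.
Qed.

End Trivial.

(** * Groups with at least two elements *)

Section Nontrivial.
Hypothesis G2 : (1 < #|G|)%N.

Lemma generators_nonempty : (0 < #|V|)%N.
Proof.
rewrite lt0n; apply/eqP => /cards0_eq V0; have [_ gen] := Vsym.
have := congr1 (fun A : {set G} => #|A|) gen.
by rewrite /= V0 gen0 cards1 cardsT => G1; have := G2; rewrite -G1.
Qed.

Let V0 := generators_nonempty.
Let n1 : 1 <= n. Proof. by rewrite (ler_nat R 1). Qed.
Let n0 : 0 < n. Proof. exact: lt_le_trans n1. Qed.

(** A difference of two delta functions is a nonzero mean-zero function, so the infimum is an
    eigenvalue; it is nonzero because [lapl] is injective on mean-zero functions. *)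
Lemma gap_laplacianP : exists2 lam : R, 0 < lam &
  gap_laplacian R V = lam%:E /\
  forall u, L20 R u -> lam * dot u u <= dot (lapl V u) u.
Proof.
have [x /setD1P[x0 _]] : exists x : G, x \in [set: G] :\ 0.
  apply/card_gt0P.
  by have := cardsD1 (0 : G) [set: G]; rewrite inE cardsT add1n => E; move: G2;
    rewrite E ltnS.
have nz : exists2 f : G -> R, L20 R f & f != 0.
  exists (fun y => (y == x)%:R - (y == 0)%:R).
    apply/sum_L20; rewrite sumrB.
    have H (z : G) : \sum_y ((y == z)%:R : R) = 1.
      by rewrite (bigD1 z)//= eqxx big1 ?addr0// => y /negbTE ->.
    by rewrite !H subrr.
  apply/eqP => /(congr1 (@^~ x)) /eqP.
  by rewrite /= eqxx (negbTE x0) subr0 oner_eq0.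
have [lam [gapE [[f [f0 [s fs] fE]] P]]] := rayleigh (@lapl_linear R G V)
  (fun f _ => lapl_L20 Vsym f) (lapl_sym Vsym V0) (fun f _ => lapl_ge0 Vsym V0 f) nz.
exists lam; last first.
  split=> //; rewrite -gapE /gap_laplacian; congr smallest_eigenvalue0.
  by apply/funext => g; apply/funext => y; rewrite lapl_laplacian.
have fn : f != 0 by apply: contraNneq fs => ->.
have lapE : lapl V f = lam *: f by apply/funext => t; exact: fE.
have := lapl_ge0 Vsym V0 f; rewrite lapE dotZl pmulr_lge0 ?dot_gt0//.
rewrite le_eqVlt => /orP[/eqP l0|//].
by case/eqP: fn; apply: (lapl_inj Vsym V0 f0); rewrite lapE -l0 scale0r.
Qed.

(** The 120 is dictated by [lyapunov_small]; [lyapunov_large] asks only for 8. *)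
Lemma lyapunov_exists lam : 0 < lam ->
  (forall u, L20 R u -> lam * dot u u <= dot (lapl V u) u) ->
  exists B, lyapunov L (120 * n * Num.max (Num.min 1 gamma / lam) gamma^-1)^-1 B.
Proof.
move=> lam0 P; set M := Num.max _ _; set r := _^-1.
have gi : gamma^-1 <= M by rewrite le_max lexx orbT.
have M0 : 0 < M by apply: lt_le_trans gi; rewrite invr_gt0.
have r0 : 0 <= r by rewrite invr_ge0 !mulr_ge0// ltW.
have nr : 120 * n * r = M^-1 by rewrite /r invfM mulrA mulfV ?mul1r// gt_eqF// mulr_gt0.
have Mg : M^-1 <= gamma by rewrite -[gamma]invrK lef_pV2 ?posrE ?invr_gt0.
have ml : Num.min 1 gamma / lam <= M by rewrite le_max lexx.
have [g1|/ltW g1] := leP 1 gamma.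
  rewrite min_l// in ml.
  have nrp : 0 <= n * r by rewrite mulr_ge0.
  exists (fun f g => 2^-1 * dot f g); apply: (lyapunov_large Vsym V0 lam0 P) => //.
    apply: (@le_trans _ _ M^-1); first by rewrite -nr; lra.
    by rewrite -[lam]invrK lef_pV2 ?posrE ?invr_gt0// -[leLHS]mul1r.
  by apply: le_trans Mg; rewrite -nr; lra.
exists (modified Vsym V0 gamma0); apply: (lyapunov_small Vsym V0 gamma0 lam0 P) => //;
  rewrite nr//.
rewrite min_r// in ml; rewrite mulrC ler_pdivrMr// mulrC -ler_pdivrMr//.
Qed.

Lemma nontrivial_tbar :
  (tbar_rel (lifted_semigroup V gamma) <= (16 * expR 1)%:E *
     maxe ((n * Num.min 1 gamma)%:E / gap_laplacian R V) ((1 + 2 * n) / gamma)%:E)%E.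
Proof.
have [lam lam0 [-> P]] := gap_laplacianP.
rewrite inver gt_eqF// -EFinM -EFin_max -EFinM.
set M := Num.max _ _.
apply: (tbar_rel_le (@lifted_gen_linear R G V gamma) (fun f _ => L20_lifted_gen gamma V0 f)).
- rewrite lt_max; apply/orP; right; by rewrite divr_gt0// addr_gt0// mulr_gt0.
- move=> f _; rewrite dot_lifted_gen// oppr_le0 addr_ge0 ?dissipation_ge0//.
  by rewrite mulr_ge0 ?dot_ge0// ltW.
- by apply: (lifted_gen_coercive Vsym V0 gamma0 lam0 P); rewrite le_max lexx ?orbT.
Qed.

Lemma nontrivial_gap :
  ((240^-1)%:E * n^-1%:E * mine (gap_laplacian R V * (Num.max 1 gamma^-1)%:E) gamma%:E
     <= spectral_gap L)%E.
Proof.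
have [lam lam0 [-> P]] := gap_laplacianP.
have [B HB] := lyapunov_exists lam0 P.
apply: le_trans (spectral_gap_ge (@lifted_gen_linear R G V gamma)
  (fun f _ => L20_lifted_gen gamma V0 f) HB).
rewrite -!EFinM -EFin_min -EFinM lee_fin.
set M := Num.max (_ / _) _; set m := Num.min (lam * _) _.
have gi : gamma^-1 <= M by rewrite le_max lexx orbT.
have M0 : 0 < M by apply: lt_le_trans gi; rewrite invr_gt0.
have -> : (120 * n * M)^-1 / 2 = 240^-1 * n^-1 * M^-1.
  by field; rewrite !gt_eqF.
rewrite ler_pM2l ?mulr_gt0 ?invr_gt0// -[leRHS]mul1r ler_pdivlMr//.
have m0 : 0 <= m.
  by rewrite le_min (ltW gamma0) andbT mulr_ge0 ?ltW// lt_max ltr01.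
have mg : m <= gamma by rewrite ge_min lexx orbT.
have ml : m <= lam * Num.max 1 gamma^-1 by rewrite ge_min lexx.
(* Each branch of the maximum [M] is paired with the branch of the minimum [m] that is its
   reciprocal. *)
rewrite /M; case: (leP (Num.min 1 gamma / lam) gamma^-1) => _; last first.
  rewrite -ler_pdivlMr ?divr_gt0 ?lt_min ?ltr01//; apply: (le_trans ml).
  rewrite mul1r invf_div ler_pM2l//.
  have [g1|/ltW g1] := leP 1 gamma.
    by rewrite max_l ?invr1// invf_le1.
  by rewrite max_r// invf_ge1.
by rewrite ler_pdivrMr// mul1r.
Qed.

Lemma nontrivial_t_rel (eps : R) : 0 < eps <= #|G|%:R ->
  (t_rel (lifted_semigroup V gamma) eps
   <= 240%:E * n%:E * maxe ((Num.min 1 gamma)%:E / gap_laplacian R V) (gamma^-1)%:E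
      * (ln (#|G|%:R / eps))%:E)%E.
Proof.
move=> he.
have [lam lam0 [-> P]] := gap_laplacianP.
have [B HB] := lyapunov_exists lam0 P.
rewrite inver gt_eqF// -EFinM -EFin_max -!EFinM.
set M := Num.max _ _ in HB *.
have gi : gamma^-1 <= M by rewrite le_max lexx orbT.
have M0 : 0 < M by apply: lt_le_trans gi; rewrite invr_gt0.
have := t_rel_le (@lifted_gen_linear R G V gamma)
  (fun f _ => L20_lifted_gen gamma V0 f) HB _ _ he.
have -> : 2 / (120 * n * M)^-1 = 240 * n * M by rewrite invrK; ring.
by apply; [rewrite invr_gt0 !mulr_gt0|rewrite (ler_nat R 2)].
Qed.

End Nontrivial.
End LiftedWalkBounds.

Theorem theorem23 (R : realType) :
  (forall (G : finZmodType) (V : {set G}) (gamma : R),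
     symmetric_generators V -> 0 < gamma ->
     (tbar_rel (lifted_semigroup V gamma)
      <= (16 * expR 1)%:E *
         maxe ((#|V|%:R * Num.min 1 gamma)%:E / gap_laplacian R V)
              ((1 + 2 * #|V|%:R) / gamma)%:E)%E) /\
  (exists c C : R, [/\ 0 < c, 0 < C &
     forall (G : finZmodType) (V : {set G}) (gamma : R),
       symmetric_generators V -> 0 < gamma ->
       (c%:E * (#|V|%:R^-1)%:E *
          mine (gap_laplacian R V * (Num.max 1 gamma^-1)%:E) gamma%:E
        <= spectral_gap (lifted_gen V gamma))%E /\
       (forall eps : R, 0 < eps <= #|G|%:R ->
          (t_rel (lifted_semigroup V gamma) eps
           <= C%:E * #|V|%:R%:E *
              maxe ((Num.min 1 gamma)%:E / gap_laplacian R V) (gamma^-1)%:E *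
              (ln (#|G|%:R / eps))%:E)%E)]).
Proof.
split=> [G V gamma Vsym gamma0|].
  have [G1|G2] := leqP #|G| 1; last exact: nontrivial_tbar.
  apply: (le_trans (trivial_tbar V gamma0 G1)); rewrite EFinM.
  apply: lee_wpmul2l; first by rewrite lee_fin mulr_ge0// expR_ge0.
  by rewrite le_max lexx orbT.
(* 240 is twice the 120 in the rate [r]: the gap is at least [r / 2], and the relaxation time
   carries [2 / r]. *)
exists 240^-1, 240; split; rewrite ?invr_gt0// => G V gamma Vsym gamma0.
have [G1|G2] := leqP #|G| 1; split.
- exact: trivial_gap.
- by move=> eps; exact: trivial_t_rel.
- exact: nontrivial_gap.
- by move=> eps; exact: nontrivial_t_rel.
Qed.
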